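(* Let $p\ge 2$ be an even integer, let $M$ be a closed geodesic subset of $U_n$, equipped with the restriction of $d_p$, and let $A \subseteq M$ be a finite subset. If $\mathrm{radius}_p(A) < \pi/2$, then $A$ has a unique circumcenter in $M$. The bound $\pi/2$ is optimal: for $M = U_1\simeq S^1$ and $A = \{1, -1\}$ one has $\mathrm{radius}_p(A) = \pi/2$ and $A$ has two circumcenters $i$ and $-i$.
   Context: $U_n$ is the unitary group, $\mathfrak{u}_n$ the skew-Hermitian matrices, $\|x\|_p=\mathrm{Tr}(|x|^p)^{1/p}$, $\|x\|_\infty$ the operator norm; $d_p$ (resp. $d_\infty$) is the infimum of $\int\|\dot\alpha\|_p$ (resp. $\int\|\dot\alpha\|_\infty$) over piecewise smooth curves in $U_n$ joining two points. For $d_\infty(u,v)<\pi$, $\gamma_{u,v}(t)=u\exp(t\log(u^{-1}v))$, $t\in[0,1]$, where $\log(w)$ is the unique $y\in\mathfrak{u}_n$ with $\|y\|_\infty<\pi$, $e^y=w$. A geodesic subset is a set $M\subseteq U_n$ any two points of which are joined by a piecewise smooth path in $M$ and such that $\gamma_{u,v}\subseteq M$ whenever $u,v\in M$ and $d_\infty(u,v)<\pi$. For a metric space $(M,d)$ and $A\subseteq M$: $\mathrm{radius}(A)=\inf\{r: \exists c\in M,\ A\subseteq B[c,r]\}$ where $B[c,r]=\{m\in M: d(c,m)\le r\}$; a circumcenter of $A$ is a point $c\in M$ with $\sup_{a\in A}d(c,a)=\mathrm{radius}(A)$. $\mathrm{radius}_p$ denotes the radius with respect to $d_p$. *)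

(* Defs.v *)
From HB Require Import structures.
From mathcomp Require Import all_boot all_order all_algebra.
From mathcomp Require Import all_classical all_reals all_analysis.
From mathcomp Require Export complex.
Import Order.TTheory GRing.Theory Num.Theory.
Import numFieldNormedType.Exports.
Set Implicit Arguments.
Unset Strict Implicit.
Unset Printing Implicit Defensive.
Local Open Scope ring_scope.
Local Open Scope classical_set_scope.

Section UnitaryDefs.
Variable R : realType.
Local Notation C := (complex R).

Definition adjmx n (x : 'M[C]_n) : 'M[C]_n := (map_mx (@conjc R) x)^T.

Definition unitary n : set 'M[C]_n := [set u | adjmx u *m u = 1%:M].

Definition skewherm n : set 'M[C]_n := [set y | adjmx y = - y].

Definition vnorm n (v : 'cV[C]_n) : R :=
  Num.sqrt (\sum_(i < n) complex.Re (v i 0 * conjc (v i 0))).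

Definition opnorm n (x : 'M[C]_n) : R :=
  sup [set vnorm (x *m v) | v in [set v : 'cV[C]_n | vnorm v = 1]].

(* Schatten p-norm for an even integer p:
   ||x||_p = Tr(|x|^p)^(1/p) with |x| = (x^* x)^(1/2), so that
   |x|^p = (x^* x)^(p/2).  Only used for even p. *)
Definition schatten (p : nat) n (x : 'M[C]_n) : R :=
  (complex.Re (\tr ((adjmx x *m x) ^+ p./2))) `^ (p%:R^-1).

Definition reC n (b : R -> 'M[C]_n) (i j : 'I_n) : R -> R :=
  fun t => complex.Re (b t i j).
Definition imC n (b : R -> 'M[C]_n) (i j : 'I_n) : R -> R :=
  fun t => complex.Im (b t i j).

Definition mxexp n (y : 'M[C]_n) : 'M[C]_n :=
  \matrix_(i, j)
    Complex
      (limn (fun N : nat => complex.Re ((\sum_(k < N) ((k`!)%:R^-1 *: y ^+ k)) i j)))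
      (limn (fun N : nat => complex.Im ((\sum_(k < N) ((k`!)%:R^-1 *: y ^+ k)) i j))).

Definition mxlog n (w : 'M[C]_n) : 'M[C]_n :=
  xget 0 [set y | skewherm y /\ opnorm y < pi /\ mxexp y = w].

Definition C1mx n (b : R -> 'M[C]_n) : Prop :=
  forall i j,
    (forall t, derivable (reC b i j) t 1) /\ continuous (reC b i j)^`() /\
    (forall t, derivable (imC b i j) t 1) /\ continuous (imC b i j)^`().

Definition mxderive n (b : R -> 'M[C]_n) (t : R) : 'M[C]_n :=
  \matrix_(i, j) Complex ((reC b i j)^`() t) ((imC b i j)^`() t).

Definition pw_smooth_path n (S : set 'M[C]_n) (a : R -> 'M[C]_n)
    (s : seq R) (b : nat -> R -> 'M[C]_n) : Prop :=
  (forall t, 0 <= t <= 1 -> S (a t)) /\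
  (1 < size s)%N /\ head 0 s = 0 /\ last 0 s = 1 /\ sorted <%R s /\
  forall i : nat, (i < (size s).-1)%N ->
    C1mx (b i) /\
    forall t, nth 0 s i <= t <= nth 0 s i.+1 -> a t = b i t.

Definition pw_length n (N : 'M[C]_n -> R) (s : seq R)
    (b : nat -> R -> 'M[C]_n) : R :=
  \sum_(i < (size s).-1)
     Rintegral lebesgue_measure `[nth 0 s i, nth 0 s i.+1]
       (fun t => N (mxderive (b i) t)).

Definition mxdist n (N : 'M[C]_n -> R) (u v : 'M[C]_n) : R :=
  inf [set L | exists a s b, pw_smooth_path (@unitary n) a s b /\
                 a 0 = u /\ a 1 = v /\ L = pw_length N s b].

Definition dinf n := mxdist (@opnorm n).
Definition dp (p : nat) n := mxdist (@schatten p n).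

Definition geod n (u v : 'M[C]_n) (t : R) : 'M[C]_n :=
  u *m mxexp ((t%:C)%C *: mxlog (invmx u *m v)).

Definition geodesic_subset n (M : set 'M[C]_n) : Prop :=
  M `<=` @unitary n /\
  (forall u v, M u -> M v ->
     exists a s b, pw_smooth_path M a s b /\ a 0 = u /\ a 1 = v) /\
  (forall u v, M u -> M v -> dinf u v < pi ->
     forall t, 0 <= t <= 1 -> M (geod u v t)).

Definition closed_in_unitary n (M : set 'M[C]_n) : Prop :=
  forall (u : nat -> 'M[C]_n) (w : 'M[C]_n),
    (forall k, M (u k)) -> @unitary n w ->
    (forall i j, (fun k => complex.Re (u k i j)) @ \oo --> complex.Re (w i j) /\
                 (fun k => complex.Im (u k i j)) @ \oo --> complex.Im (w i j)) ->
    M w.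

End UnitaryDefs.
Arguments unitary : clear implicits.

Section MetricDefs.
Variable R : realType.
Variable T : Type.

Definition cball (M : set T) (d : T -> T -> R) (c : T) (r : R) : set T :=
  [set m | M m /\ d c m <= r].

Definition set_radius (M : set T) (d : T -> T -> R) (A : set T) : R :=
  inf [set r | exists2 c, M c & A `<=` cball M d c r].

Definition circumcenter (M : set T) (d : T -> T -> R) (A : set T) (c : T) : Prop :=
  M c /\ sup [set d c a | a in A] = set_radius M d A.

End MetricDefs.

(* Main.v *)
Require Import Defs.
From HB Require Import structures.
From mathcomp Require Import all_boot all_order all_algebra.
From mathcomp Require Import all_classical all_reals all_analysis.
From mathcomp Require Import complex.
From mathcomp Require Import spectral ring lra.
Set Implicit Arguments.
Unset Strict Implicit.
Unset Printing Implicit Defensive.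
Import Order.TTheory GRing.Theory Num.Theory.
Import numFieldNormedType.Exports.
Local Open Scope ring_scope.
Local Open Scope classical_set_scope.

(** The distance is explicit: if [u^* v] has eigenvalues [exp(i th_j)] with
    [|th_j| <= pi], then [dp u v ^ p = H (u^* v)] where [H w = sum_j th_j ^ p].
    Writing [w = V exp(i th) V^*] and [u = U exp(i ph) U^*], the numbers
    [q_jk = |(V^* U)_jk|^2] are doubly stochastic, so every scalar inequality
    between [ph ^ p] and [th ^ p + p th ^ (p - 1) sin (ph - th)] sums to an
    inequality between [H u] and [H w + Im tr (G w^* u)] with
    [G = V (p th ^ (p - 1)) V^*].  The upper inequality, with error
    [1 - cos (ph - th)], makes [H] continuous and bounds its growth along a curve by
    Hoelder, so no curve is shorter than the one-parameter group.  The lower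
    inequality holds for angles below [pi / 2]; applied to [w e] and [w e^-1] its
    linear terms cancel because [tr (G (e + e^-1))] is real, so [H] is strictly
    midpoint convex there.  Existence of a circumcenter then follows from compactness,
    and uniqueness because the midpoint of two circumcenters, which lies in [M], would
    be a strictly better center. *)

(** [H] has a kink where an angle crosses [pi], that is, where [-1] is an eigenvalue, so its growth
    along a curve cannot be found by differentiating it. The upper inequality supplies instead, at
    each time, a differentiable majorant touching [H] there, and a barrier argument needs no more.
    This is why that inequality must hold for all angles up to [pi], and why its error is [1 - cos]:
    weighted by the [q_jk], it sums to half the squared Frobenius distance, which is of second
    order.

    The bound [pi / 2] enters twice. In the scalar lower inequality it is what
    [|d - sin d| <= d ^ 2 / pi] allows. In the geometry it keeps numerical ranges in the open right
    half-plane, which excludes the eigenvalue [-1] from [c1^* c2] for two centers, so that the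
    geodesic condition on [M] applies to them, and which also bounds the angles of the midpoint. *)

Section ScalarInequalities.
Context {R : realType}.
Implicit Types (x y t s d : R) (p : nat).

(** * Trigonometric inequalities and tangent inequalities for powers *)

Lemma is_derive_continuous (f df : R -> R) :
  (forall x, is_derive x 1 f (df x)) -> continuous f.
Proof.
move=> H x; apply: differentiable_continuous; apply/derivable1_diffP.
by case: (H x).
Qed.

(* The difference of the two sides vanishes at [0] and [pi / 2], and its derivative
   [2 / pi - sin x] is decreasing. *)
Lemma cos_ge_chord x : 0 <= x <= pi / 2 -> 1 - 2 * x / pi <= cos x.
Proof.
move=> /andP[x0 xp]; rewrite leNgt; apply/negP => kx.
have pi0 := @pi_gt0 R.
pose k (y : R) := cos y - (1 - 2 * y / pi).
pose dk (y : R) := - sin y + 2 / pi.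
have Dk y : is_derive y (1 : R) k (dk y).
  rewrite /k /dk; apply: is_derive_eq.
  by rewrite /GRing.scale /=; ring.
have ck := is_derive_continuous Dk.
have k0 : k 0 = 0 by rewrite /k cos0; ring.
have kp : k (pi / 2) = 0 by rewrite /k cos_pihalf; move: (@pi R) pi0 => P P0; field; exact: lt0r_neq0.
have kx0 : k x < 0 by rewrite /k subr_lt0.
have x0' : 0 < x.
  by rewrite lt_neqAle x0 andbT; apply: contraTneq kx0 => <-; rewrite k0 ltxx.
have xp' : x < pi / 2.
  by rewrite lt_neqAle xp andbT; apply: contraTneq kx0 => ->; rewrite kp ltxx.
have [a] := MVT x0' (fun y _ => Dk y) (continuous_subspaceT ck).
rewrite in_itv /= => /andP[a0 ax]; rewrite k0 !subr0 => Ea.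
have [b] := MVT xp' (fun y _ => Dk y) (continuous_subspaceT ck).
rewrite in_itv /= => /andP[xb bp]; rewrite kp sub0r => Eb.
have sa : dk a < 0 by rewrite -(pmulr_llt0 (dk a) x0') -Ea.
have sb : 0 < dk b.
  by rewrite -(pmulr_lgt0 (dk b) (_ : 0 < pi / 2 - x)) -?Eb ?oppr_gt0 // subr_gt0.
have : sin a < sin b.
  by rewrite ltr_sin ?in_itv /=; [lra | apply/andP; split; lra ..].
by rewrite /dk in sa sb; lra.
Qed.

(** Integrated form of [cos_ge_chord]: the difference of the two sides vanishes at [0] and has
    nonnegative derivative. *)
Lemma sin_ge_parabola_half x : 0 <= x <= pi / 2 -> x - x ^+ 2 / pi <= sin x.
Proof.
move=> /andP[x0 xp]; have pi0 := @pi_gt0 R.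
pose f (y : R) := sin y - (y - y ^+ 2 / pi).
pose df (y : R) := cos y - (1 - 2 * y / pi).
have Df y : is_derive y (1 : R) f (df y).
  rewrite /f /df; apply: is_derive_eq.
  by rewrite /GRing.scale /=; ring.
have cf := is_derive_continuous Df.
have [c] := MVT_segment x0 (fun y _ => Df y) (continuous_subspaceT cf).
rewrite in_itv /= => /andP[c0 cx].
rewrite {2}/f sin0 expr0n /= mul0r !subr0 => E.
rewrite -subr_ge0 -/(f x) E mulr_ge0 // /df subr_ge0 cos_ge_chord // c0 /=; lra.
Qed.

(** Both sides are invariant under [x |-> pi - x], which reduces the claim to the first half. *)
Lemma sin_ge_parabola x : 0 <= x <= pi -> x - x ^+ 2 / pi <= sin x.
Proof.
move=> /andP[x0 xp]; have [xh|xh] := leP x (pi / 2).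
  by apply: sin_ge_parabola_half; rewrite x0.
have pi0 := @pi_gt0 R.
have := @sin_ge_parabola_half (pi - x).
rewrite sinB sinpi cospi mul0r mulN1r opprK add0r.
have -> : pi - x - (pi - x) ^+ 2 / pi = x - x ^+ 2 / pi.
  by move: (@pi R) pi0 => P P0; field; exact: lt0r_neq0.
by apply; apply/andP; split; lra.
Qed.

Lemma sin_le_id x : 0 <= x -> sin x <= x.
Proof.
move=> x0.
have [c _] := MVT_segment x0 (fun y _ => is_derive_sin y)
  (continuous_subspaceT (@continuous_sin R)).
by rewrite sin0 !subr0 => ->; rewrite ler_piMl // cos_le1.
Qed.

(** The constant [1 / pi] decides the range of the lower inequality: multiplied by [2 * |t|] with
    [|t| < pi / 2], the bound stays below [d ^ 2]. *)
Lemma abs_subr_sin d : `|d| <= pi -> `|d - sin d| <= d ^+ 2 / pi.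
Proof.
wlog d0 : d / 0 <= d => [H dp|].
  have [/H|/ltW d0] := leP 0 d; first exact.
  have := H (- d); rewrite sinN normrN sqrrN -opprD normrN.
  by apply; rewrite ?oppr_ge0.
rewrite (ger0_norm d0) => dp.
rewrite ger0_norm ?subr_ge0 ?sin_le_id //.
by have := @sin_ge_parabola d; rewrite d0 dp => /(_ isT); lra.
Qed.

(** For [0 <= d <= pi] the parabola bound gives [sin (d / 2) >= d / 4], and [1 - cos d] is twice the
    square of that sine. This converts quadratic Taylor errors into the trigonometric error that
    sums to a trace. *)
Lemma sqr_le_cos d : `|d| <= pi -> d ^+ 2 <= 8 * (1 - cos d).
Proof.
wlog d0 : d / 0 <= d => [H dp|].
  have [/H|/ltW d0] := leP 0 d; first exact.
  by have := H (- d); rewrite cosN normrN sqrrN; apply; rewrite ?oppr_ge0.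
rewrite (ger0_norm d0) => dp; have pi0 := @pi_gt0 R.
have := @sin_ge_parabola (d / 2).
have -> : d / 2 - (d / 2) ^+ 2 / pi = d / 4 + d * (pi - d) / (4 * pi).
  by move: (@pi R) pi0 => P P0; field; exact: lt0r_neq0.
have q : 0 <= d * (pi - d) / (4 * pi).
  by rewrite divr_ge0 ?mulr_ge0 //; lra.
move=> /(_ _)/wrap[]; first by apply/andP; split; lra.
move=> s1; have {}s1 : d / 4 <= sin (d / 2) by lra.
have := cos_mulr2n (d / 2).
have -> : d / 2 *+ 2 = d by rewrite -mulr_natr divfK.
move=> ->; rewrite cos2sin2 -mulr_natr.
have : (d / 4) ^+ 2 <= sin (d / 2) ^+ 2 by apply: lerXn2r => //; rewrite nnegrE; lra.
lra.
Qed.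

(** Multiplying the inequality for [m] by [y] leaves, over the one for [m + 1], exactly the gap
    [m * x ^ (m - 1) * (y - x) ^ 2]. *)
Lemma pow_tangent (m : nat) x y : 0 <= x -> 0 <= y ->
  x ^+ m + m%:R * x ^+ m.-1 * (y - x) <= y ^+ m.
Proof.
move=> x0 y0; elim: m => [|m IH]; first by rewrite !expr0 !mul0r addr0.
have := ler_wpM2l y0 IH; rewrite -exprS; apply: le_trans.
case: m {IH} => [|m]; first by rewrite /= !expr0 expr1 mul0r; lra.
rewrite [m.+1.-1]/= [m.+2.-1]/= !exprS -natr1 -[in leLHS]natr1.
set z := x ^+ m; have z0 : 0 <= z by rewrite exprn_ge0.
have := mulr_ge0 z0 (sqr_ge0 (y - x)).
have := mulr_ge0 (ler0n R m) (mulr_ge0 z0 (sqr_ge0 (y - x))).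
by rewrite -natr1; set k := m%:R; nra.
Qed.

(** [pow_tangent] at the squares [x ^ 2] and [y ^ 2], followed by
    [y ^ 2 - x ^ 2 >= 2 * x * (y - x)]; passing through squares allows arbitrary signs. *)
Lemma pow_tangent_even p x y : ~~ odd p ->
  x ^+ p + p%:R * x ^+ p.-1 * (y - x) <= y ^+ p.
Proof.
move=> ep; pose m := p./2; have pE : p = (2 * m)%N.
  by rewrite mul2n -[LHS]odd_double_half (negbTE ep).
case: m pE => [|m] ->; first by rewrite muln0 !expr0 !mul0r addr0.
have := @pow_tangent m.+1 (x ^+ 2) (y ^+ 2) (sqr_ge0 _) (sqr_ge0 _).
rewrite -!exprM; apply: le_trans.
have -> : ((2 * m.+1).-1 = (2 * m).+1)%N by rewrite mulnS.
rewrite natrM /= exprS exprM lerD2l.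
have z0 : 0 <= (x ^+ 2) ^+ m by rewrite exprn_ge0 ?sqr_ge0.
have := mulr_ge0 (ler0n R m.+1) (mulr_ge0 z0 (sqr_ge0 (y - x))).
rewrite -!exprM; set z := _ ^+ _; set k := m.+1%:R; nra.
Qed.

(* Convexity of [u |-> u ^ (p / 2)] reduces the claim to the case [p = 2]. *)
Lemma pow_sin_lower p t s : (2 <= p)%N -> ~~ odd p ->
  `|t| < pi / 2 -> `|s| < pi / 2 ->
  t ^+ p + p%:R * t ^+ p.-1 * sin (s - t) <= s ^+ p ?= iff (s == t).
Proof.
move=> p2 ep tp sp; apply/leifP; case: eqP => [->|/eqP st].
  by rewrite subrr sin0 mulr0 addr0.
have pi0 := @pi_gt0 R.
have d0 : 0 < (s - t) ^+ 2 by rewrite exprn_even_gt0 //= subr_eq0.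
have q2 : 2 * t * sin (s - t) < s ^+ 2 - t ^+ 2.
  have dp : `|s - t| <= pi.
    by rewrite (le_trans (ler_normB _ _)) //; move: tp sp; lra.
  have := abs_subr_sin dp; set w := sin _; set d := s - t => dw.
  have : `|2 * t * (d - w)| < d ^+ 2.
    rewrite !normrM ger0_norm //.
    apply: (@le_lt_trans _ _ (2 * `|t| * (d ^+ 2 / pi))).
      by rewrite ler_wpM2l // mulr_ge0.
    rewrite mulrCA -[ltRHS]mulr1 ltr_pM2l //.
    by rewrite ltr_pdivrMr // mul1r; lra.
  by rewrite ltr_norml => /andP[+ _]; rewrite /d; nra.
pose m := p./2; have pE : p = (2 * m)%N.
  by rewrite mul2n -[LHS]odd_double_half (negbTE ep).
have m0 : (0 < m)%N by move: p2; rewrite pE; case: (m).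
case: (m) m0 pE => // k _ ->.
have -> : ((2 * k.+1).-1 = (2 * k).+1)%N by rewrite mulnS.
have [t0|t0] := eqVneq t 0.
  rewrite t0 !expr0n /= mulr0 mul0r addr0 exprM exprn_gt0 //.
  by rewrite exprn_even_gt0 //= -t0.
apply: (@lt_le_trans _ _ ((t ^+ 2) ^+ k.+1
   + k.+1%:R * (t ^+ 2) ^+ k * (s ^+ 2 - t ^+ 2))); last first.
  have := @pow_tangent k.+1 (t ^+ 2) (s ^+ 2) (sqr_ge0 _) (sqr_ge0 _).
  by rewrite -!exprM.
rewrite -!exprM ltrD2l exprS natrM.
have z0 : 0 < t ^+ (2 * k) by rewrite exprM exprn_gt0 // exprn_even_gt0.
have := mulr_gt0 (ltr0Sn R k) z0; set z := t ^+ _; set n := k.+1%:R => nz.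
have := ltr_pM2l nz (2 * t * sin (s - t)) (s ^+ 2 - t ^+ 2).
rewrite q2 => /idP; apply: le_lt_trans; rewrite le_eqVlt; apply/orP; left.
by apply/eqP; ring.
Qed.

(** The remainder for [p + 1] is [s] times the one for [p], plus an explicit multiple of
    [(s - t) ^ 2]. It is applied with [B = 3 * pi], which leaves room for an angle shifted by a full
    turn. *)
Lemma pow_taylor2 p (B : R) : 0 <= B -> exists2 K : R, 0 <= K &
  forall t s, `|t| <= B -> `|s| <= B ->
   `|s ^+ p - t ^+ p - p%:R * t ^+ p.-1 * (s - t)| <= K * (s - t) ^+ 2.
Proof.
move=> B0; elim: p => [|p [K K0 IH]].
  exists 0 => // t s _ _; rewrite !expr0 subrr !mul0r subr0 normr0 //.
exists (B * K + p%:R * B ^+ p.-1) => [|t s tB sB].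
  by rewrite addr_ge0 ?mulr_ge0 ?exprn_ge0.
have -> : s ^+ p.+1 - t ^+ p.+1 - p.+1%:R * t ^+ p.+1.-1 * (s - t) =
   s * (s ^+ p - t ^+ p - p%:R * t ^+ p.-1 * (s - t))
   + p%:R * t ^+ p.-1 * (s - t) ^+ 2.
  case: (p) => [|q] /=; first by rewrite !expr0 !expr1; ring.
  by rewrite !exprS -!natr1; ring.
rewrite (le_trans (ler_normD _ _)) // mulrDl lerD //.
  by rewrite normrM -(mulrA B); apply: ler_pM => //; exact: IH.
rewrite 2!normrM (ger0_norm (sqr_ge0 (s - t))).
rewrite ler_wpM2r ?sqr_ge0 // ger0_norm // ler_wpM2l //.
by rewrite normrX lerXn2r // nnegrE.
Qed.

(* When [|s - t| > pi], replace [s] by [s -+ 2 pi], the same point of the circle but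
   closer to [t] on the line and larger in absolute value. *)
Lemma pow_sin_upper p : ~~ odd p -> exists2 K : R, 0 <= K &
  forall t s, `|t| <= pi -> `|s| <= pi ->
  s ^+ p <= t ^+ p + p%:R * t ^+ p.-1 * sin (s - t) + K * (1 - cos (s - t)).
Proof.
move=> ep; have pi0 := @pi_gt0 R.
have [|K K0 HK] := @pow_taylor2 p (3 * pi); first by rewrite mulr_ge0 // ltW.
pose L : R := p%:R * pi ^+ p.-1.
have L0 : 0 <= L by rewrite mulr_ge0 // exprn_ge0 // ltW.
exists (8 * (K + L / pi)).
  by rewrite mulr_ge0 // addr_ge0 // divr_ge0 // ltW.
have near t s : `|t| <= pi -> `|s| <= 3 * pi -> `|s - t| <= pi ->
    s ^+ p <= t ^+ p + p%:R * t ^+ p.-1 * sin (s - t)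
      + 8 * (K + L / pi) * (1 - cos (s - t)).
  move=> tp sp dp.
  have t3 : `|t| <= 3 * pi by lra.
  have := HK t s t3 sp; rewrite ler_norml => /andP[_].
  have dc := sqr_le_cos dp.
  have : `|p%:R * t ^+ p.-1 * ((s - t) - sin (s - t))| <= L / pi * (s - t) ^+ 2.
    rewrite -(mulrA L) normrM [_^-1 * _]mulrC; apply: ler_pM; rewrite ?abs_subr_sin //.
    rewrite normrM /L ger0_norm // ler_wpM2l // normrX lerXn2r // nnegrE; exact: ltW.
  rewrite ler_norml => /andP[_].
  have : 0 <= (K + L / pi) * (8 * (1 - cos (s - t)) - (s - t) ^+ 2).
    by rewrite mulr_ge0 ?subr_ge0 // addr_ge0 // divr_ge0 // ltW.
  set z := p%:R * t ^+ p.-1; set c := cos _; set w := sin _; nra.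
have powle x y : `|x| <= `|y| -> x ^+ p <= y ^+ p.
  move=> xy; have E z : z ^+ p = (`|z| ^+ p : R).
    rewrite -[p]odd_double_half (negbTE ep) add0n -mul2n !exprM.
    by rewrite real_normK ?num_real.
  by rewrite (E x) (E y) lerXn2r // nnegrE.
move=> t s tp sp; have [dp|dp] := leP (`|s - t|) pi.
  by apply: near => //; lra.
wlog st : t s tp sp dp / t <= s => [H|].
  have [/H|/ltW st] := leP t s; first exact.
  have := H (- t) (- s); rewrite !normrN -opprD normrN => /(_ tp sp dp).
  rewrite lerN2 => /(_ st); rewrite sinN cosN.
  rewrite (exprNn s) (exprNn t p) (exprNn t p.-1).
  rewrite -signr_odd (negbTE ep) expr0 !mul1r.
  case: (p) ep => [|q] eq; first by rewrite !mul0r.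
  rewrite [q.+1.-1]/= -[(-1) ^+ q]signr_odd; move: eq; rewrite /= negbK => ->.
  by rewrite expr1 mulN1r !mulrN mulNr opprK.
rewrite ger0_norm ?subr_ge0 // in dp.
move: (tp) (sp); rewrite !ler_norml => /andP[t1 t2] /andP[s1 s2].
have E : s - 2 * pi - t = s - t - pi *+ 2 by rewrite -mulr_natr; ring.
have sE : sin (s - 2 * pi - t) = sin (s - t) by rewrite E -[LHS]sinD2pi subrK.
have cE : cos (s - 2 * pi - t) = cos (s - t) by rewrite E -[LHS]cosD2pi subrK.
have s3 : `|s - 2 * pi| <= 3 * pi by rewrite ler_norml; apply/andP; split; lra.
have d1 : `|s - 2 * pi - t| <= pi by rewrite ler_norml; apply/andP; split; lra.
have := near t (s - 2 * pi) tp s3 d1; rewrite sE cE; apply: le_trans.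
apply: powle; rewrite [leRHS]ler0_norm; last by lra.
by apply: le_trans sp _; lra.
Qed.

End ScalarInequalities.

(** * Real and imaginary parts, and points of the unit circle given by angles *)

Section ComplexParts.
Context {R : realType}.
Local Notation C := R[i].
Local Notation cRe := (@complex.Re R).
Local Notation cIm := (@complex.Im R).
Implicit Types (z w : C) (t s : R).

Lemma cReD z w : cRe (z + w) = cRe z + cRe w. Proof. by case: z; case: w. Qed.
Lemma cImD z w : cIm (z + w) = cIm z + cIm w. Proof. by case: z; case: w. Qed.
Lemma cReN z : cRe (- z) = - cRe z. Proof. by case: z. Qed.
Lemma cImN z : cIm (- z) = - cIm z. Proof. by case: z. Qed.
Lemma cReB z w : cRe (z - w) = cRe z - cRe w. Proof. by case: z; case: w. Qed.
Lemma cImB z w : cIm (z - w) = cIm z - cIm w. Proof. by case: z; case: w. Qed.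
Lemma cReM z w : cRe (z * w) = cRe z * cRe w - cIm z * cIm w.
Proof. by case: z; case: w. Qed.
Lemma cImM z w : cIm (z * w) = cRe z * cIm w + cIm z * cRe w.
Proof. by case: z => a b; case: w => c d. Qed.
Lemma cRe_conj z : cRe (conjc z) = cRe z. Proof. by case: z. Qed.
Lemma cIm_conj z : cIm (conjc z) = - cIm z. Proof. by case: z. Qed.

Lemma cRe_sum (I : Type) (r : seq I) (P : pred I) (F : I -> C) :
  cRe (\sum_(i <- r | P i) F i) = \sum_(i <- r | P i) cRe (F i).
Proof. by apply: (big_morph cRe cReD). Qed.
Lemma cIm_sum (I : Type) (r : seq I) (P : pred I) (F : I -> C) :
  cIm (\sum_(i <- r | P i) F i) = \sum_(i <- r | P i) cIm (F i).
Proof. by apply: (big_morph cIm cImD). Qed.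

Lemma complex_eqP z w : cRe z = cRe w -> cIm z = cIm w -> z = w.
Proof. by case: z; case: w => a b c d /= -> ->. Qed.

Definition nsq z : R := cRe z ^+ 2 + cIm z ^+ 2.

Lemma nsqE z : (nsq z)%:C%C = z * conjc z.
Proof. by apply: complex_eqP; rewrite ?cReM ?cImM cRe_conj cIm_conj /nsq /=; ring. Qed.

Lemma nsq_ge0 z : 0 <= nsq z. Proof. by rewrite addr_ge0 ?sqr_ge0. Qed.

Lemma nsq_eq0 z : nsq z = 0 -> z = 0.
Proof.
move=> /eqP; rewrite paddr_eq0 ?sqr_ge0 // !sqrf_eq0 => /andP[/eqP a /eqP b].
exact: complex_eqP.
Qed.

Definition expi t : C := Complex (cos t) (sin t).

Lemma expiD t s : expi (t + s) = expi t * expi s.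
Proof.
by apply: complex_eqP; rewrite ?cReM ?cImM /= ?cosD ?sinD //; ring.
Qed.

Lemma conjc_expi t : conjc (expi t) = expi (- t).
Proof. by rewrite /expi cosN sinN. Qed.

Lemma expi0 : expi 0 = 1. Proof. by rewrite /expi cos0 sin0. Qed.

Lemma expi_argument z : nsq z = 1 -> exists2 t, `|t| <= pi & z = expi t.
Proof.
case: z => a b; rewrite /nsq /= => ab.
have a1 : -1 <= a <= 1.
  by have b0 := sqr_ge0 b; apply/andP; split; nra.
have sa : sin (acos a) = `|b|.
  by rewrite sin_acos // -ab addrAC subrr add0r sqrtr_sqr.
have ca : cos (acos a) = a by rewrite acosK // in_itv.
have acp : `|acos a| <= pi by rewrite ger0_norm ?acos_ge0 ?acos_lepi.
have [b0|b0] := leP 0 b.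
  by exists (acos a) => //; rewrite /expi ca sa ger0_norm.
exists (- acos a); first by rewrite normrN.
by rewrite /expi cosN sinN ca sa ltr0_norm // opprK.
Qed.

End ComplexParts.

(** * Spectral decompositions and the comparison of two eigenbases *)

Section Unitary.
Context {R : realType} {n : nat}.
Local Notation C := R[i].
Local Notation cRe := (@complex.Re R).
Local Notation cIm := (@complex.Im R).
Implicit Types (x y u v w V U W : 'M[C]_n) (f g : 'I_n -> C).

Lemma adjmxE x i j : adjmx x i j = conjc (x j i).
Proof. by rewrite !mxE. Qed.

Lemma adjmxM x y : adjmx (x *m y) = adjmx y *m adjmx x.
Proof. by rewrite /adjmx map_mxM trmx_mul. Qed.

Lemma adjmxK x : adjmx (adjmx x) = x.
Proof. by apply/matrixP => i j; rewrite !adjmxE conjcK. Qed.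

Lemma adjmxD x y : adjmx (x + y) = adjmx x + adjmx y.
Proof. by apply/matrixP => i j; rewrite !(adjmxE, mxE) rmorphD. Qed.

Lemma adjmxN x : adjmx (- x) = - adjmx x.
Proof. by apply/matrixP => i j; rewrite !(adjmxE, mxE) rmorphN. Qed.

Lemma adjmx1 : adjmx (1%:M : 'M[C]_n) = 1%:M.
Proof. by apply/matrixP => i j; rewrite !(adjmxE, mxE) eq_sym; case: eqP; rewrite ?conjc1 ?conjc0. Qed.

Lemma unitary_mulVmx u : unitary R n u -> adjmx u *m u = 1%:M.
Proof. by []. Qed.

Lemma unitary_mulmxV u : unitary R n u -> u *m adjmx u = 1%:M.
Proof. by move=> /mulmx1C. Qed.

Lemma unitary_adj u : unitary R n u -> unitary R n (adjmx u).
Proof. by move=> /unitary_mulmxV; rewrite /unitary /= adjmxK. Qed.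

Lemma unitary_mul u v : unitary R n u -> unitary R n v -> unitary R n (u *m v).
Proof.
move=> uu uv; rewrite /unitary /= adjmxM -mulmxA (mulmxA _ u v).
by rewrite (unitary_mulVmx uu) mul1mx.
Qed.

Lemma unitary1 : unitary R n 1%:M.
Proof. by rewrite /unitary /= adjmx1 mulmx1. Qed.

Lemma unitary_invmx u : unitary R n u -> invmx u = adjmx u.
Proof.
move=> uu; have [_ uU] := mulmx1_unit (unitary_mulVmx uu).
by rewrite -[LHS]mul1mx -(unitary_mulVmx uu) mulmxK.
Qed.

(** The eigenbasis is an argument, not a choice made from the matrix, because decompositions in
    different bases have to be compared. *)
Definition sdec V f : 'M[C]_n := V *m diag_mx (\row_i f i) *m adjmx V.

Lemma eq_sdec V f g : f =1 g -> sdec V f = sdec V g.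
Proof. by move=> fg; rewrite /sdec; congr (_ *m diag_mx _ *m _); apply/rowP => i; rewrite !mxE. Qed.

Lemma sdecE V f i j : sdec V f i j = \sum_k V i k * f k * conjc (V j k).
Proof.
by rewrite mxE; apply: eq_bigr => k _; rewrite mul_mx_diag !mxE.
Qed.

Lemma sdecM V f g : unitary R n V ->
  sdec V f *m sdec V g = sdec V (fun i => f i * g i).
Proof.
move=> uV; rewrite /sdec !mulmxA -(mulmxA _ (adjmx V) V) (unitary_mulVmx uV) mulmx1.
rewrite -(mulmxA V) mulmx_diag; congr (_ *m diag_mx _ *m _).
by apply/rowP => i; rewrite !mxE.
Qed.

Lemma sdec_adj V f : adjmx (sdec V f) = sdec V (fun i => conjc (f i)).
Proof.
apply/matrixP => i j; rewrite adjmxE !sdecE rmorph_sum; apply: eq_bigr => k _.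
by rewrite !rmorphM /= conjcK; ring.
Qed.

Lemma sdecD V f g : sdec V f + sdec V g = sdec V (fun i => f i + g i).
Proof.
apply/matrixP => i j; rewrite mxE !sdecE -big_split; apply: eq_bigr => k _ /=.
by ring.
Qed.

Lemma sdecZ V a f : a *: sdec V f = sdec V (fun i => a * f i).
Proof.
apply/matrixP => i j; rewrite mxE !sdecE mulr_sumr; apply: eq_bigr => k _ /=.
by ring.
Qed.

Lemma sdec1 V : unitary R n V -> sdec V (fun=> 1) = 1%:M.
Proof.
move=> uV; rewrite /sdec; have -> : \row_i (1 : C) = const_mx 1 :> 'rV_n.
  by apply/rowP => i; rewrite !mxE.
by rewrite diag_const_mx mulmx1 unitary_mulmxV.
Qed.

Lemma sdecX V f k : unitary R n V -> sdec V f ^+ k = sdec V (fun i => f i ^+ k).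
Proof.
move=> uV; elim: k => [|k IH]; first by rewrite expr0 -idmxE -(sdec1 uV).
rewrite exprS IH -mulmxE sdecM //; apply: eq_sdec => i; by rewrite exprS.
Qed.

Lemma mxtrace_sdec V f : unitary R n V -> \tr (sdec V f) = \sum_i f i.
Proof.
move=> uV; rewrite mxtrace_mulC mulmxA (unitary_mulVmx uV) mul1mx mxtrace_diag.
by apply: eq_bigr => i _; rewrite mxE.
Qed.

Lemma sdec_inj V f g : unitary R n V -> sdec V f = sdec V g -> f =1 g.
Proof.
move=> uV /(congr1 (fun x => adjmx V *m x *m V)).
rewrite /sdec !mulmxA (unitary_mulVmx uV) !mul1mx -!mulmxA (unitary_mulVmx uV) !mulmx1.
move=> E i; move/matrixP: E => /(_ i i); by rewrite !mxE eqxx.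
Qed.

(** The spectral theorem gives [x = P^-1 D P] with [P] unitary, so the basis sought is the adjoint
    of [spectralmx x]. *)
Lemma normal_sdec x : x *m adjmx x = adjmx x *m x ->
  exists2 V, unitary R n V & exists f, x = sdec V f.
Proof.
move=> nx.
have conjE (m : nat) (y : 'M[C]_(m, n)) : map_mx Num.conj y^T = (map_mx (@conjc R) y)^T.
  by apply/matrixP => i j; rewrite !mxE.
have /orthomx_spectralP E : x \is normalmx by apply/normalmxP; rewrite conjE.
have uP := spectral_unitarymx x; have uPm := uP; move/unitarymxP: uPm.
rewrite conjE -/(adjmx _) => uP'.
exists (adjmx (spectralmx x)); first by rewrite /unitary /= adjmxK.
exists (fun i => spectral_diag x 0 i).
have iv : invmx (spectralmx x) = adjmx (spectralmx x).
  by rewrite (invmx_unitary uP) conjE.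
rewrite [LHS]E iv /sdec adjmxK.
have -> // : \row_i spectral_diag x 0 i = spectral_diag x.
by apply/rowP => i; rewrite mxE.
Qed.

Lemma unitary_sdec w : unitary R n w ->
  exists2 V, unitary R n V &
  exists2 th : 'I_n -> R, (forall i, `|th i| <= pi) & w = sdec V (expi \o th).
Proof.
move=> uw; have [|V uV [f E]] := @normal_sdec w.
  by rewrite unitary_mulmxV // unitary_mulVmx.
exists V => //; have f1 i : nsq (f i) = 1.
  have := unitary_mulVmx uw; rewrite E sdec_adj sdecM // -(sdec1 uV).
  move=> /(sdec_inj uV)/(_ i); rewrite mulrC -nsqE => /(congr1 cRe); exact.
have /choice[th Hth] : forall i, exists t : R, `|t| <= pi /\ f i = expi t.
  by move=> i; have [t t1 t2] := expi_argument (f1 i); exists t.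
exists th => [i|]; first by case: (Hth i).
by rewrite E; apply: eq_sdec => i /=; case: (Hth i).
Qed.

Lemma sdec_expi_unitary V (th : 'I_n -> R) : unitary R n V ->
  unitary R n (sdec V (expi \o th)).
Proof.
move=> uV; rewrite /unitary /= sdec_adj sdecM // -(sdec1 uV).
by apply: eq_sdec => i; rewrite [in LHS]/comp conjc_expi -expiD addNr expi0.
Qed.

Definition overlap V U j k : R := nsq ((adjmx V *m U) j k).

Lemma overlap_ge0 V U j k : 0 <= overlap V U j k. Proof. exact: nsq_ge0. Qed.

Lemma sum_row_nsq x j : \sum_k (nsq (x j k)) = cRe ((x *m adjmx x) j j).
Proof.
rewrite mxE cRe_sum; apply: eq_bigr => k _; by rewrite adjmxE -nsqE.
Qed.

Lemma sum_overlap_l V U j : unitary R n V -> unitary R n U ->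
  \sum_k overlap V U j k = 1.
Proof.
move=> uV uU; rewrite sum_row_nsq unitary_mulmxV ?mxE ?eqxx //.
by apply: unitary_mul => //; exact: unitary_adj.
Qed.

Lemma sum_overlap_r V U k : unitary R n V -> unitary R n U ->
  \sum_j overlap V U j k = 1.
Proof.
move=> uV uU; rewrite -(sum_overlap_l k uU uV); apply: eq_bigr => j _.
rewrite /overlap; have -> : adjmx U *m V = adjmx (adjmx V *m U).
  by rewrite adjmxM adjmxK.
by rewrite adjmxE /nsq cRe_conj cIm_conj sqrrN.
Qed.

Lemma mxtrace_sdecM V U f g : unitary R n V -> unitary R n U ->
  \tr (sdec V f *m sdec U g) = \sum_j \sum_k f j * g k * (overlap V U j k)%:C%C.
Proof.
move=> uV uU; set Q := adjmx V *m U.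
have -> : sdec V f *m sdec U g =
    V *m (diag_mx (\row_i f i) *m (sdec Q g *m adjmx V)).
  by rewrite /sdec adjmxM adjmxK !mulmxA -!(mulmxA _ V (adjmx V)) (unitary_mulmxV uV) !mulmx1.
rewrite mxtrace_mulC -(mulmxA (diag_mx _)) -(mulmxA (sdec Q g)) (unitary_mulVmx uV) mulmx1.
rewrite /mxtrace; apply: eq_bigr => j _; rewrite mul_diag_mx mxE sdecE mxE mulr_sumr.
by apply: eq_bigr => k _; rewrite nsqE -/Q; ring.
Qed.

Lemma Im_mxtrace_sdec V U (th ph a : 'I_n -> R) : unitary R n V -> unitary R n U ->
  cIm (\tr (sdec V (fun i => (a i)%:C%C) *m adjmx (sdec V (expi \o th))
            *m sdec U (expi \o ph)))
  = \sum_j \sum_k overlap V U j k * (a j * sin (ph k - th j)).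
Proof.
move=> uV uU; rewrite sdec_adj sdecM // mxtrace_sdecM // cIm_sum.
apply: eq_bigr => j _; rewrite cIm_sum; apply: eq_bigr => k _ /=.
by rewrite sinB; ring.
Qed.

Lemma Re_mxtrace_sdec V U (th ph : 'I_n -> R) : unitary R n V -> unitary R n U ->
  cRe (\tr (adjmx (sdec V (expi \o th)) *m sdec U (expi \o ph)))
  = \sum_j \sum_k overlap V U j k * cos (ph k - th j).
Proof.
move=> uV uU; rewrite sdec_adj mxtrace_sdecM // cRe_sum.
apply: eq_bigr => j _; rewrite cRe_sum; apply: eq_bigr => k _ /=.
by rewrite cosB; ring.
Qed.

Lemma sum_overlap_rowE V U (a : 'I_n -> R) : unitary R n V -> unitary R n U ->
  \sum_j \sum_k overlap V U j k * a j = \sum_j a j.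
Proof.
move=> uV uU; apply: eq_bigr => j _.
by rewrite -mulr_suml sum_overlap_l // mul1r.
Qed.

Lemma sum_overlap_colE V U (b : 'I_n -> R) : unitary R n V -> unitary R n U ->
  \sum_j \sum_k overlap V U j k * b k = \sum_k b k.
Proof.
move=> uV uU; rewrite exchange_big; apply: eq_bigr => k _ /=.
by rewrite -mulr_suml sum_overlap_r // mul1r.
Qed.

(** Squared Frobenius norm, entrywise so that limits and derivatives can be read off the entries. *)
Definition frosq x : R := \sum_i \sum_j nsq (x i j).

Lemma frosq_ge0 x : 0 <= frosq x.
Proof. by apply: sumr_ge0 => i _; apply: sumr_ge0 => j _; exact: nsq_ge0. Qed.

Lemma frosqE x : frosq x = cRe (\tr (adjmx x *m x)).
Proof.
rewrite mxtrace_mulC /mxtrace cRe_sum; apply: eq_bigr => i _.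
exact: sum_row_nsq.
Qed.

Lemma cRe_mxtrace_adj x : cRe (\tr (adjmx x)) = cRe (\tr x).
Proof. by rewrite /mxtrace !cRe_sum; apply: eq_bigr => i _; rewrite adjmxE cRe_conj. Qed.

Lemma cRe_nat (k : nat) : cRe k%:R = k%:R.
Proof. by elim: k => // k IH; rewrite -!natr1 cReD IH. Qed.

(** By [Re_mxtrace_sdec] the left side is the overlap-weighted sum of [1 - cos (ph k - th j)]; the
    identity turns these errors into a distance. *)
Lemma unitary_frosq u w : unitary R n u -> unitary R n w ->
  n%:R - cRe (\tr (adjmx w *m u)) = frosq (u - w) / 2.
Proof.
move=> uu uw; rewrite frosqE adjmxD adjmxN mulmxDl !mulmxDr !mulmxN !mulNmx opprK.
rewrite (unitary_mulVmx uu) (unitary_mulVmx uw) !mxtraceD !raddfN /= mxtrace1.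
rewrite -[adjmx u *m w]adjmxK adjmxM adjmxK.
rewrite !(cReD, cReN) cRe_mxtrace_adj cRe_nat.
by field.
Qed.

End Unitary.

(** * The sum of powers of eigenvalue angles and its first-order inequalities *)

Section AnglePowerSum.
Context {R : realType} {n : nat}.
Local Notation C := R[i].
Local Notation cRe := (@complex.Re R).
Local Notation cIm := (@complex.Im R).
Implicit Types (x y u v w V U W e : 'M[C]_n) (th ph et : 'I_n -> R) (p : nat).

(** The function [H] of the overview. It is picked among the values given by all decompositions;
    [specpowE] shows that for even [p] they agree, although an eigenvalue [-1] may be given the
    angle [pi] or [- pi]. *)
Definition specpow p w : R := xget 0 [set h | exists V th,
  [/\ unitary R n V, forall i, `|th i| <= pi, w = sdec V (expi \o th)
    & h = \sum_i th i ^+ p]].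

Definition pow_grad p V th : 'M[C]_n :=
  sdec V (fun i => (p%:R * th i ^+ p.-1)%:C%C).

(** Stated for decompositions and not for [specpow], since it serves to prove [specpow] well
    defined. The constant is halved by [unitary_frosq]. *)
Lemma sum_pow_upper p : ~~ odd p -> exists2 K : R, 0 <= K &
  forall V U th ph, unitary R n V -> unitary R n U ->
    (forall i, `|th i| <= pi) -> (forall i, `|ph i| <= pi) ->
    \sum_i ph i ^+ p <= \sum_i th i ^+ p
      + cIm (\tr (pow_grad p V th *m adjmx (sdec V (expi \o th)) *m sdec U (expi \o ph)))
      + K * frosq (sdec U (expi \o ph) - sdec V (expi \o th)).
Proof.
move=> ep; have [K K0 HK] := @pow_sin_upper R p ep; exists (K / 2).
  by rewrite divr_ge0.
move=> V U th ph uV uU hth hph.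
rewrite -mulrA [2^-1 * _]mulrC -unitary_frosq; try exact: sdec_expi_unitary.
rewrite Im_mxtrace_sdec // Re_mxtrace_sdec //.
rewrite -(sum_overlap_colE (fun k => ph k ^+ p) uV uU).
rewrite -(sum_overlap_rowE (fun k => th k ^+ p) uV uU).
have -> : n%:R = \sum_j \sum_k overlap V U j k * 1 :> R.
  by rewrite (sum_overlap_rowE (fun=> 1) uV uU) sumr_const card_ord.
rewrite mulrBr !mulr_sumr -big_split /= -sumrB -big_split /=.
apply: ler_sum => j _; rewrite !mulr_sumr -big_split /= -sumrB -big_split /=.
apply: ler_sum => k _.
have := ler_wpM2l (overlap_ge0 V U j k) (HK (th j) (ph k) (hth j) (hph k)).
by lra.
Qed.

(** For two decompositions of one matrix the quadratic term of [sum_pow_upper] vanishes, and the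
    linear one is the imaginary part of a real trace. Each sum of powers is thus at most the
    other. *)
Lemma specpowE p V th : ~~ odd p -> unitary R n V -> (forall i, `|th i| <= pi) ->
  specpow p (sdec V (expi \o th)) = \sum_i th i ^+ p.
Proof.
move=> ep uV hth; rewrite /specpow; case: xgetP => [y _|/(_ (\sum_i th i ^+ p))]; last first.
  by case; exists V, th.
case=> U [ph [uU hph E ->]].
have [K K0 HK] := sum_pow_upper ep.
have half V1 th1 U1 th2 : unitary R n V1 -> unitary R n U1 ->
    (forall i, `|th1 i| <= pi) -> (forall i, `|th2 i| <= pi) ->
    sdec V1 (expi \o th1) = sdec U1 (expi \o th2) ->
    \sum_i th2 i ^+ p <= \sum_i th1 i ^+ p.
  move=> uV1 uU1 h1 h2 E1; have := HK V1 U1 th1 th2 uV1 uU1 h1 h2.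
  rewrite -E1 subrr; have -> : frosq (0 : 'M[C]_n) = 0.
    rewrite /frosq big1 // => i _; rewrite big1 // => j _.
    by rewrite mxE /nsq /= expr0n addr0.
  rewrite mulr0 addr0 -mulmxA (unitary_mulVmx (sdec_expi_unitary _ uV1)) mulmx1.
  have -> : cIm (\tr (pow_grad p V1 th1)) = 0; last by rewrite addr0.
  by rewrite /pow_grad mxtrace_sdec // cIm_sum big1.
by apply/eqP; rewrite eq_le (half V th U ph) // (half U ph V th).
Qed.

Lemma specpow_upper p : ~~ odd p -> exists2 K : R, 0 <= K &
  forall V th u w, unitary R n V -> (forall i, `|th i| <= pi) -> unitary R n u ->
    w = sdec V (expi \o th) ->
    specpow p u <= specpow p w + cIm (\tr (pow_grad p V th *m adjmx w *m u))
      + K * frosq (u - w).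
Proof.
move=> ep; have [K K0 HK] := sum_pow_upper ep; exists K => // V th u w uV hth uu ->.
have [U uU [ph hph ->]] := unitary_sdec uu.
by rewrite !specpowE //; exact: HK.
Qed.

Lemma frosqN x : frosq (- x) = frosq x.
Proof.
rewrite /frosq; apply: eq_bigr => i _; apply: eq_bigr => j _.
by rewrite mxE /nsq cReN cImN !sqrrN.
Qed.

(** The linear term of the upper inequality is of first order in the distance. Young's inequality
    trades it for a constant plus a multiple of [sin ^ 2 <= 2 * (1 - cos)], so only [frosq], and no
    square root of it, appears. *)
Lemma specpow_modulus p (eps : R) : ~~ odd p -> 0 < eps -> exists2 K : R, 0 <= K &
  forall u w, unitary R n u -> unitary R n w ->
    `|specpow p u - specpow p w| <= eps + K * frosq (u - w).
Proof.
move=> ep eps0; have [K K0 HK] := sum_pow_upper ep.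
pose L : R := p%:R * pi ^+ p.-1.
have L0 : 0 <= L by rewrite mulr_ge0 // exprn_ge0 // pi_ge0.
(* The overlaps have total weight [n], so the constants add up to [n%:R * eta <= eps]; [n.+1] keeps
   [eta] positive when [n = 0]. *)
pose eta : R := eps / n.+1%:R; have eta0 : 0 < eta by rewrite divr_gt0.
pose M : R := L ^+ 2 / (4 * eta).
have M0 : 0 <= M by rewrite divr_ge0 ?sqr_ge0 // mulr_ge0 // ltW.
exists (K + M); first by rewrite addr_ge0.
have term (a t : R) : `|a| <= L -> a * sin t <= eta + M * (2 * (1 - cos t)).
  move=> aL; have s2 : sin t ^+ 2 <= 2 * (1 - cos t).
    have := mulr_ge0 (_ : 0 <= 1 - cos t) (_ : 0 <= 1 - cos t).
    by rewrite sin2cos2 subr_ge0 cos_le1 => /(_ isT isT); lra.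
  have aLs : a * sin t <= L * `|sin t|.
    by rewrite (le_trans (ler_norm _)) // normrM ler_wpM2r.
  have Ms : M * sin t ^+ 2 <= M * (2 * (1 - cos t)) by rewrite ler_wpM2l.
  have sq : 0 <= (eta - L * `|sin t| / 2) ^+ 2 / eta.
    by rewrite divr_ge0 ?sqr_ge0 // ltW.
  have sqE : (eta - L * `|sin t| / 2) ^+ 2 / eta = eta + M * sin t ^+ 2 - L * `|sin t|.
    rewrite -(real_normK (num_real (sin t))) /M.
    by field; rewrite gt_eqF.
  by lra.
have half u w : unitary R n u -> unitary R n w ->
    specpow p u <= specpow p w + (eps + (K + M) * frosq (u - w)).
  move=> uu uw; have [V uV [th hth Ew]] := unitary_sdec uw.
  have [U uU [ph hph Eu]] := unitary_sdec uu.
  have := HK V U th ph uV uU hth hph; rewrite -Ew -Eu => H.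
  have Sw : specpow p w = \sum_i th i ^+ p by rewrite Ew specpowE.
  have Su : specpow p u = \sum_i ph i ^+ p by rewrite Eu specpowE.
  rewrite Sw Su (le_trans H) // -addrA lerD2l mulrDl addrCA.
  rewrite [leRHS]addrC lerD2r {H}.
  have -> : frosq (u - w) = 2 * (n%:R - cRe (\tr (adjmx w *m u))).
    by rewrite unitary_frosq // mulrC divfK.
  rewrite Eu Ew Im_mxtrace_sdec // Re_mxtrace_sdec //.
  apply: (@le_trans _ _ (n%:R * eta + M * (2 * (n%:R -
      \sum_j \sum_k overlap V U j k * cos (ph k - th j))))); last first.
    rewrite lerD2r /eta mulrA ler_pdivrMr // mulrC ler_pM2l // ler_nat //.
  have -> : n%:R = \sum_j \sum_k overlap V U j k * 1 :> R.
    by rewrite (sum_overlap_rowE (fun=> 1) uV uU) sumr_const card_ord.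
  rewrite -sumrB !mulr_sumr mulr_suml -big_split /=.
  apply: ler_sum => j _; rewrite -sumrB !mulr_sumr mulr_suml -big_split /=.
  apply: ler_sum => k _.
  have aL : `|p%:R * th j ^+ p.-1| <= L.
    rewrite normrM ger0_norm // ler_wpM2l // normrX lerXn2r // nnegrE; exact: pi_ge0.
  have := ler_wpM2l (overlap_ge0 V U j k) (term _ (ph k - th j) aL).
  by lra.
move=> u w uu uw; have h1 := half u w uu uw; have := half w u uw uu.
by rewrite -(opprB u w) frosqN ler_norml => h2; apply/andP; split; lra.
Qed.

Lemma specpow_ge0 p w : ~~ odd p -> unitary R n w -> 0 <= specpow p w.
Proof.
move=> ep uw; have [V uV [th hth ->]] := unitary_sdec uw.
by rewrite specpowE // sumr_ge0 // => i _; rewrite exprn_even_ge0.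
Qed.

Lemma specpow_adj p w : ~~ odd p -> unitary R n w -> specpow p (adjmx w) = specpow p w.
Proof.
move=> ep uw; have [V uV [th hth ->]] := unitary_sdec uw.
rewrite sdec_adj (@eq_sdec _ _ V _ (expi \o (fun i => - th i))); last first.
  by move=> i; rewrite /comp conjc_expi.
rewrite !specpowE // => [|i]; last by rewrite normrN.
by apply: eq_bigr => i _; rewrite exprNn -signr_odd (negbTE ep) mul1r.
Qed.

Lemma sum_pow_lt_angle p th (c : R) : (0 < p)%N -> ~~ odd p -> 0 <= c ->
  \sum_i th i ^+ p < c ^+ p -> forall i, `|th i| < c.
Proof.
move=> p0 ep c0 H i; rewrite ltNge; apply/negP => ci.
have : c ^+ p <= th i ^+ p.
  have -> : th i ^+ p = `|th i| ^+ p.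
    rewrite -[p]odd_double_half (negbTE ep) add0n -mul2n !exprM.
    by rewrite real_normK ?num_real.
  by rewrite lerXn2r // nnegrE.
rewrite leNgt => /negP; apply; apply: le_lt_trans H.
rewrite (bigD1 i) //= lerDl sumr_ge0 // => j _; by rewrite exprn_even_ge0.
Qed.

(** Strictness: if [ph k = th j] whenever the overlap is nonzero, then [adjmx V *m U] intertwines
    the two diagonal matrices and [u = w]. Some term with positive weight is therefore strict. *)
Lemma specpow_lower p V U th ph : (2 <= p)%N -> ~~ odd p ->
  unitary R n V -> unitary R n U ->
  (forall i, `|th i| < pi / 2) -> (forall i, `|ph i| < pi / 2) ->
  let w := sdec V (expi \o th) in let u := sdec U (expi \o ph) in u <> w ->
  specpow p w + cIm (\tr (pow_grad p V th *m adjmx w *m u)) < specpow p u.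
Proof.
move=> p2 ep uV uU hth hph w u uw.
have pi0 := @pi_gt0 R.
have [j [k [jk0 jk]]] : exists j k, overlap V U j k != 0 /\ ph k != th j.
  apply: contrapT => H; apply: uw; rewrite /u /w /sdec.
  have E : diag_mx (\row_i (expi \o th) i) *m (adjmx V *m U)
      = (adjmx V *m U) *m diag_mx (\row_i (expi \o ph) i).
    apply/matrixP => j k; rewrite mul_diag_mx mul_mx_diag !mxE -/(overlap _ _ _ _) [RHS]mulrC.
    have [jk|jk] := eqVneq (ph k) (th j); first by rewrite /= jk.
    have [jk0|jk0] := eqVneq (overlap V U j k) 0; last first.
      by case: H; exists j, k.
    by move: (nsq_eq0 jk0); rewrite mxE => ->; rewrite !mulr0.
  have -> : V *m diag_mx (\row_i (expi \o th) i) *m adjmx V =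
     V *m (diag_mx (\row_i (expi \o th) i) *m (adjmx V *m U)) *m adjmx U.
    by rewrite !mulmxA -(mulmxA _ U) (unitary_mulmxV uU) mulmx1.
  by rewrite E !mulmxA (unitary_mulmxV uV) mul1mx.
have {}jk0 : 0 < overlap V U j k by rewrite lt_neqAle eq_sym jk0 overlap_ge0.
have lt_le (c : R) : c < pi / 2 -> c <= pi by lra.
rewrite /w /u !specpowE //; try by move=> i; apply: lt_le.
rewrite Im_mxtrace_sdec //.
rewrite -(sum_overlap_colE (fun k => ph k ^+ p) uV uU).
rewrite -(sum_overlap_rowE (fun k => th k ^+ p) uV uU).
rewrite -big_split /=.
have term i l : overlap V U i l * th i ^+ p
    + overlap V U i l * (p%:R * th i ^+ p.-1 * sin (ph l - th i))
    <= overlap V U i l * ph l ^+ p.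
  rewrite -mulrDr ler_wpM2l ?overlap_ge0 //.
  by have [] := pow_sin_lower p2 ep (hth i) (hph l).
rewrite (bigD1 j) //= [ltRHS](bigD1 j) //= ltr_leD //; last first.
  by apply: ler_sum => i _; rewrite -big_split; apply: ler_sum => l _; exact: term.
rewrite -big_split /= (bigD1 k) //= [ltRHS](bigD1 k) //= ltr_leD //; last first.
  by apply: ler_sum.
rewrite -mulrDr ltr_pM2l //.
have /leifP := pow_sin_lower p2 ep (hth j) (hph k); by rewrite (negbTE jk).
Qed.

(** A value of the numerical range, at the [j]-th column of [V], written as an average of
    eigenvalues. *)
Lemma diag_conj_sdec V U (f : 'I_n -> C) j :
  (adjmx V *m sdec U f *m V) j j = \sum_k f k * (overlap V U j k)%:C%C.
Proof.
have -> : adjmx V *m sdec U f *m V = sdec (adjmx V *m U) f.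
  by rewrite /sdec adjmxM adjmxK !mulmxA.
by rewrite sdecE; apply: eq_bigr => k _; rewrite nsqE; ring.
Qed.

Lemma sum_overlap_gt0 V U (a : 'I_n -> R) j : unitary R n V -> unitary R n U ->
  (forall k, 0 < a k) -> 0 < \sum_k a k * overlap V U j k.
Proof.
move=> uV uU a0; rewrite lt_neqAle eq_sym sumr_ge0 ?andbT; last first.
  by move=> k _; rewrite mulr_ge0 ?overlap_ge0 // ltW.
apply/eqP => /eqP; rewrite psumr_eq0; last first.
  by move=> k _; rewrite mulr_ge0 ?overlap_ge0 // ltW.
move=> /allP H; have := sum_overlap_l j uV uU; rewrite big1 => [/eqP|k _].
  by rewrite eq_sym oner_eq0.
have := H k (mem_index_enum k); rewrite mulf_eq0 gt_eqF //=; by move/eqP.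
Qed.

Lemma Re_diag_conj_gt0 V U ph j : unitary R n V -> unitary R n U ->
  (forall k, `|ph k| < pi / 2) ->
  0 < cRe ((adjmx V *m sdec U (expi \o ph) *m V) j j).
Proof.
move=> uV uU hph; rewrite diag_conj_sdec cRe_sum.
rewrite (eq_bigr (fun k => cos (ph k) * overlap V U j k)); last first.
  by move=> k _; rewrite cReM /= mulr0 subr0.
apply: sum_overlap_gt0 => // k; apply: cos_gt0_pihalf.
by rewrite -ltr_norml.
Qed.

Lemma cos_gt0_angle (t : R) : `|t| <= pi -> 0 < cos t -> `|t| < pi / 2.
Proof.
move=> tp; rewrite -cos_norm => c0; rewrite ltNge; apply/negP => pt.
have pi0 := @pi_gt0 R.
have : (cos (pi / 2) < cos `|t|) = (`|t| < pi / 2).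
  by apply: ltr_cos; rewrite in_itv /= ?normr_ge0 ?tp //; apply/andP; split; lra.
by rewrite cos_pihalf c0 ltNge pt.
Qed.

(** Here a bound on a distance becomes a bound on every single angle: for even [p] each summand is
    at most the whole sum. *)
Lemma specpow_lt_angle p w (c : R) : (0 < p)%N -> ~~ odd p -> unitary R n w ->
  0 <= c <= pi -> specpow p w < c ^+ p ->
  exists2 V, unitary R n V &
  exists2 th, (forall i, `|th i| < c) & w = sdec V (expi \o th).
Proof.
move=> p0 ep uw /andP[c0 cp]; have [V uV [th hth ->]] := unitary_sdec uw.
rewrite specpowE // => H; exists V => //; exists th => //.
exact: (sum_pow_lt_angle p0 ep c0 H).
Qed.

Lemma expi_angle_pi (t : R) : `|t| <= pi -> ~~ (`|t| < pi) -> expi t = -1.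
Proof.
rewrite -leNgt => t1 t2; have tp : `|t| = pi by apply/eqP; rewrite eq_le t1.
apply: complex_eqP; rewrite ?cReN ?cImN /=.
  by rewrite -cos_norm tp cospi.
have [t0|t0] := leP 0 t; first by move: tp; rewrite ger0_norm // => ->; rewrite sinpi oppr0.
by move: tp; rewrite ltr0_norm // => tp; rewrite -[t]opprK tp sinN sinpi.
Qed.

(* [-1] cannot be an eigenvalue of [u^* v]: an eigenvector would give opposite
   values to the numerical ranges of [u] and [v], both in the right half-plane. *)
Lemma right_half_plane_angle p u v V th : (0 < p)%N -> ~~ odd p ->
  unitary R n u -> unitary R n v -> specpow p u < (pi / 2) ^+ p ->
  specpow p v < (pi / 2) ^+ p -> unitary R n V -> (forall i, `|th i| <= pi) ->
  adjmx u *m v = sdec V (expi \o th) -> forall i, `|th i| < pi.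
Proof.
move=> p0 ep uu uv hu hv uV hth E i; apply: contraT => thi.
have pi0 := @pi_gt0 R.
have hp : 0 <= (pi : R) / 2 <= pi by apply/andP; split; lra.
have [U1 uU1 [p1 hp1 E1]] := specpow_lt_angle p0 ep uu hp hu.
have [U2 uU2 [p2 hp2 E2]] := specpow_lt_angle p0 ep uv hp hv.
have := Re_diag_conj_gt0 i uV uU2 hp2; rewrite -E2.
have -> : v = u *m sdec V (expi \o th).
  by rewrite -E mulmxA (unitary_mulmxV uu) mul1mx.
have -> : adjmx V *m (u *m sdec V (expi \o th)) *m V =
    (adjmx V *m u *m V) *m diag_mx (\row_k (expi \o th) k).
  by rewrite /sdec !mulmxA -(mulmxA _ (adjmx V)) (unitary_mulVmx uV) mulmx1.
rewrite mul_mx_diag mxE [X in _ * X]mxE /comp (expi_angle_pi (hth i) thi).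
rewrite mulrN1 cReN oppr_gt0 => H.
by have := Re_diag_conj_gt0 i uV uU1 hp1; rewrite -E1 ltNge (ltW H).
Qed.

Lemma specpow_midpoint p w e W et : (2 <= p)%N -> ~~ odd p ->
  unitary R n w -> unitary R n W -> (forall i, `|et i| < pi / 2) ->
  e = sdec W (expi \o et) -> e <> 1%:M ->
  specpow p (w *m e) < (pi / 2) ^+ p -> specpow p (w *m adjmx e) < (pi / 2) ^+ p ->
  2 * specpow p w < specpow p (w *m e) + specpow p (w *m adjmx e).
Proof.
move=> p2 ep uw uW het Ee e1 h1 h2; have p0 : (0 < p)%N by apply: leq_trans p2.
have ue : unitary R n e by rewrite Ee; exact: sdec_expi_unitary.
have pi0 := @pi_gt0 R.
have hp : 0 <= (pi : R) / 2 <= pi by apply/andP; split; lra.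
have u1 := unitary_mul uw ue; have u2 := unitary_mul uw (unitary_adj ue).
have [U1 uU1 [p1 hp1 E1]] := specpow_lt_angle p0 ep u1 hp h1.
have [U2 uU2 [p2' hp2 E2]] := specpow_lt_angle p0 ep u2 hp h2.
have [V uV [th hth' Ew]] := unitary_sdec uw.
have ee : e + adjmx e = sdec W (fun k => (2 * cos (et k))%:C%C).
  rewrite Ee sdec_adj sdecD; apply: eq_sdec => k /=.
  by apply: complex_eqP; rewrite /= ?subrr //; ring.
have cet k : 0 < 2 * cos (et k).
  by rewrite mulr_gt0 // cos_gt0_pihalf // -ltr_norml.
(* [specpow_lower] also needs the angles of the midpoint [w] below [pi / 2]. In an eigenbasis of
   [w], the [j]-th diagonal entry of [w *m (e + adjmx e)] is [expi (th j)] times a positive real,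
   and its real part is positive because those of [w *m e] and [w *m adjmx e] are. *)
have hth j : `|th j| < pi / 2.
  apply: cos_gt0_angle => //.
  have := Re_diag_conj_gt0 j uV uU2 hp2; have := Re_diag_conj_gt0 j uV uU1 hp1.
  rewrite -E1 -E2 => a1 a2; have := addr_gt0 a1 a2; rewrite -cReD.
  set x := adjmx V *m _ *m V; set y := adjmx V *m _ *m V.
  have -> : x j j + y j j = (x + y) j j by rewrite [RHS]mxE.
  have -> : x + y = diag_mx (\row_k (expi \o th) k) *m (adjmx V *m (e + adjmx e) *m V).
    rewrite /x /y -mulmxDl -mulmxDr -mulmxDr Ew /sdec.
    by rewrite !mulmxA (unitary_mulVmx uV) mul1mx.
  rewrite mul_diag_mx mxE [X in X * _]mxE ee diag_conj_sdec.
  rewrite (eq_bigr (fun k => (2 * cos (et k) * overlap V W j k)%:C%C)); last first.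
    by move=> k _; rewrite -rmorphM.
  rewrite -rmorph_sum cReM /= mulr0 subr0 pmulr_lgt0 //.
  exact: sum_overlap_gt0.
have ne a : a <> 1%:M -> w *m a <> w.
  move=> a1 /(congr1 (mulmx (adjmx w))); rewrite mulmxA (unitary_mulVmx uw) mul1mx.
  exact: a1.
have ne1 : adjmx e <> 1%:M.
  by move=> /(congr1 (@adjmx R n)); rewrite adjmxK adjmx1.
have := specpow_lower p2 ep uV uU1 hth hp1; rewrite /= -Ew -E1 => /(_ (ne _ e1)).
have := specpow_lower p2 ep uV uU2 hth hp2; rewrite /= -Ew -E2 => /(_ (ne _ ne1)).
rewrite -2!mulmxA !(mulmxA (adjmx w)) (unitary_mulVmx uw) !mul1mx => a b.
have := ltrD a b; rewrite addrACA -cImD -mxtraceD -mulmxDr [adjmx e + e]addrC ee.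
rewrite mxtrace_sdecM // cIm_sum big1; last first.
  move=> j _; rewrite cIm_sum big1 // => k _.
  by rewrite -!rmorphM.
by lra.
Qed.

(** [nsq (x j j)] is at most the squared norm of column [j], which is the [j]-th diagonal entry of
    [adjmx x *m x]; Jensen's inequality in an eigenbasis of that matrix moves the power inside. *)
Lemma diag_pow_le x (m : nat) j :
  nsq (x j j) ^+ m <= cRe (((adjmx x *m x) ^+ m) j j).
Proof.
have [|U uU [f Ef]] := @normal_sdec R n (adjmx x *m x).
  by rewrite adjmxM adjmxK.
(* An eigenvalue of [adjmx x *m x] is the squared norm of a column of [x *m U], hence real and
   nonnegative. *)
have fE k : f k = (\sum_i nsq ((x *m U) i k))%:C%C.
  have : (adjmx U *m (adjmx x *m x) *m U) k k = f k.
    rewrite Ef /sdec !mulmxA (unitary_mulVmx uU) mul1mx -mulmxA (unitary_mulVmx uU).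
    by rewrite mulmx1 !mxE eqxx.
  move=> <-; have -> : adjmx U *m (adjmx x *m x) *m U = adjmx (x *m U) *m (x *m U).
    by rewrite adjmxM !mulmxA.
  rewrite mxE rmorph_sum; apply: eq_bigr => i _.
  by rewrite adjmxE mulrC -nsqE.
pose a k := \sum_i nsq ((x *m U) i k).
have a0 k : 0 <= a k by apply: sumr_ge0 => i _; exact: nsq_ge0.
have diagE l : cRe (((adjmx x *m x) ^+ l) j j) = \sum_k nsq (U j k) * a k ^+ l.
  rewrite Ef sdecX // sdecE cRe_sum; apply: eq_bigr => k _.
  rewrite fE -rmorphXn mulrAC -nsqE -rmorphM //.
have w1 : \sum_k nsq (U j k) = 1.
  by rewrite sum_row_nsq unitary_mulmxV // mxE eqxx.
set y0 := cRe ((adjmx x *m x) j j).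
have y0E : y0 = \sum_k nsq (U j k) * a k by have := diagE 1%N; rewrite expr1.
have y00 : 0 <= y0.
  by rewrite y0E sumr_ge0 // => k _; rewrite mulr_ge0 ?nsq_ge0.
apply: (@le_trans _ _ (y0 ^+ m)).
  rewrite lerXn2r ?nnegrE ?nsq_ge0 // /y0 mxE cRe_sum (bigD1 j) //=.
  rewrite adjmxE mulrC -nsqE /= lerDl sumr_ge0 // => i _.
  by rewrite adjmxE mulrC -nsqE /= nsq_ge0.
rewrite diagE.
(* Jensen by the tangent at the mean [y0]: the weights sum to 1 and average [a] to [y0], so the
   linear terms cancel. *)
have -> : y0 ^+ m = \sum_k nsq (U j k) * (y0 ^+ m + m%:R * y0 ^+ m.-1 * (a k - y0)).
  rewrite (eq_bigr (fun k => nsq (U j k) * (y0 ^+ m - m%:R * y0 ^+ m.-1 * y0)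
       + m%:R * y0 ^+ m.-1 * (nsq (U j k) * a k))); last by move=> k _; ring.
  by rewrite big_split /= -mulr_suml w1 -mulr_sumr -y0E; ring.
by apply: ler_sum => k _; rewrite ler_wpM2l ?nsq_ge0 // pow_tangent.
Qed.

Definition schpow p x : R := cRe (\tr ((adjmx x *m x) ^+ p./2)).

Lemma schpow_ge0 p x : 0 <= schpow p x.
Proof.
rewrite /schpow /mxtrace cRe_sum sumr_ge0 // => j _.
by apply: le_trans (diag_pow_le _ _ _); rewrite exprn_ge0 ?nsq_ge0.
Qed.

Lemma schpow_unitary_conj p x U V : unitary R n U -> unitary R n V ->
  schpow p (U *m x *m V) = schpow p x.
Proof.
move=> uU uV; rewrite /schpow.
have -> : adjmx (U *m x *m V) *m (U *m x *m V) = adjmx V *m (adjmx x *m x) *m V.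
  by rewrite !adjmxM !mulmxA -(mulmxA _ (adjmx U)) (unitary_mulVmx uU) mulmx1.
have -> k : (adjmx V *m (adjmx x *m x) *m V) ^+ k = adjmx V *m (adjmx x *m x) ^+ k *m V.
  elim: k => [|k IH]; first by rewrite !expr0 -idmxE mulmx1 (unitary_mulVmx uV).
  rewrite !exprS IH -!mulmxE !mulmxA.
  by rewrite -(mulmxA _ V (adjmx V)) (unitary_mulmxV uV) mulmx1.
by rewrite mxtrace_mulC mulmxA (unitary_mulmxV uV) mul1mx.
Qed.

(** A pinching inequality. Imaginary parts are what is wanted, since the imaginary part of a trace
    against a real diagonal matrix sees only these. *)
Lemma sum_diag_pow_le p x : ~~ odd p -> \sum_j (cIm (x j j)) ^+ p <= schpow p x.
Proof.
move=> ep; rewrite /schpow /mxtrace cRe_sum; apply: ler_sum => j _.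
apply: le_trans (diag_pow_le _ _ _).
rewrite -[X in _ ^+ X <= _]odd_double_half (negbTE ep) add0n -mul2n exprM.
by rewrite lerXn2r ?nnegrE ?sqr_ge0 ?nsq_ge0 // /nsq lerDr sqr_ge0.
Qed.

(** The tangent inequality rearranged is Young's inequality
    [p x ^ (p - 1) y <= (p - 1) x ^ p + y ^ p]; it is summed over [x = a i / S], [y = b i / N]. *)
Lemma hoelder_even p (a b : 'I_n -> R) (S N : R) : (0 < p)%N -> ~~ odd p -> 0 < S -> 0 < N ->
  \sum_i a i ^+ p <= S ^+ p -> \sum_i b i ^+ p <= N ^+ p ->
  \sum_i a i ^+ p.-1 * b i <= S ^+ p.-1 * N.
Proof.
move=> p0 ep S0 N0 ha hb.
have Sp : 0 < S ^+ p by rewrite exprn_gt0.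
have Np : 0 < N ^+ p by rewrite exprn_gt0.
have q0 : 0 < p%:R :> R by rewrite ltr0n.
pose D := S ^+ p.-1 * N; have D0 : 0 < D by rewrite mulr_gt0 // exprn_gt0.
rewrite -/D -[D]mul1r -ler_pdivrMr //.
suff : p%:R * ((\sum_i a i ^+ p.-1 * b i) / D) <= p%:R * 1 by rewrite ler_pM2l.
have tang i : p%:R * (a i ^+ p.-1 * b i / D) <=
    (p%:R - 1) * (a i ^+ p / S ^+ p) + b i ^+ p / N ^+ p.
  have := @pow_tangent_even R p (a i / S) (b i / N) ep; rewrite !expr_div_n.
  have -> : a i ^+ p.-1 * b i / D = (a i ^+ p.-1 / S ^+ p.-1) * (b i / N).
    by rewrite /D invfM; ring.
  have -> : a i ^+ p / S ^+ p = a i ^+ p.-1 / S ^+ p.-1 * (a i / S).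
    by case: (p) p0 => // q _; rewrite !exprSr /= invfM; ring.
  by lra.
rewrite mulr_suml mulr_sumr.
apply: le_trans (ler_sum _ (fun i _ => tang i)) _.
rewrite big_split /= -mulr_sumr -!mulr_suml.
have s1 : (\sum_i a i ^+ p) / S ^+ p <= 1 by rewrite ler_pdivrMr // mul1r.
have s2 : (\sum_i b i ^+ p) / N ^+ p <= 1 by rewrite ler_pdivrMr // mul1r.
have p1 : 0 <= p%:R - 1 :> R by rewrite subr_ge0 ler1n.
by have := ler_wpM2l p1 s1; lra.
Qed.

(** The bound is the derivative of [S ^ p] when [S] grows at rate [N]: to first order, [H ^ (1 / p)]
    grows no faster than the length. In the eigenbasis [V] only the diagonal of [y] contributes, so
    pinching and Hoelder apply. *)
Lemma pow_grad_le p V th x (S N : R) : (0 < p)%N -> ~~ odd p -> unitary R n V ->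
  0 < S -> 0 < N -> \sum_i th i ^+ p <= S ^+ p -> schpow p x <= N ^+ p ->
  cIm (\tr (pow_grad p V th *m adjmx (sdec V (expi \o th)) *m x)) <= p%:R * (S ^+ p.-1 * N).
Proof.
move=> p0 ep uV S0 N0 hS hN; set w := sdec V _.
have uw : unitary R n w by exact: sdec_expi_unitary.
pose y := adjmx V *m (adjmx w *m x) *m V.
have -> : \tr (pow_grad p V th *m adjmx w *m x) =
    \tr (diag_mx (\row_i (p%:R * th i ^+ p.-1)%:C%C) *m y).
  by rewrite /pow_grad /sdec -!mulmxA mxtrace_mulC !mulmxA.
have -> : cIm (\tr (diag_mx (\row_i (p%:R * th i ^+ p.-1)%:C%C) *m y)) =
    p%:R * \sum_i th i ^+ p.-1 * cIm (y i i).
  rewrite /mxtrace cIm_sum mulr_sumr; apply: eq_bigr => i _.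
  by rewrite mul_diag_mx mxE [X in X * _]mxE cImM /= mul0r addr0 mulrA.
rewrite ler_wpM2l //; apply: hoelder_even => //.
apply: le_trans (sum_diag_pow_le y ep) _.
rewrite /y mulmxA schpow_unitary_conj //.
by apply: unitary_mul; exact: unitary_adj.
Qed.

End AnglePowerSum.

(** * Real analysis on an interval: barriers, roots, primitives *)

Section Barrier.
Context {R : realType}.

(** Suppose [g t1 > 0] and let [T] be the supremum of the times up to [t1] with [g <= 0]. Past [T]
    the sign persists, by continuity if [g T < 0] and by the last hypothesis if [g T = 0],
    contradicting the choice of [T]. That hypothesis can be checked on a majorant of [g]. *)
Lemma le0_barrier (g : R -> R) (l r : R) :
  (forall t, l <= t <= r -> forall eps : R, 0 < eps -> exists2 d : R, 0 < d &
     forall s, l <= s <= r -> `|s - t| < d -> `|g s - g t| < eps) ->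
  g l <= 0 ->
  (forall t, l <= t < r -> g t = 0 -> exists2 d : R, 0 < d &
     forall s, l <= s <= r -> t < s < t + d -> g s <= 0) ->
  forall t, l <= t <= r -> g t <= 0.
Proof.
move=> cg gl step t1 /andP[lt1 t1r]; rewrite leNgt; apply/negP => gt1.
pose A : set R := [set t | l <= t <= t1 /\ g t <= 0].
have Al : A l by split; rewrite ?lexx.
have ubA : has_ubound A by exists t1 => t [/andP[]].
have supA : has_sup A by split; first by exists l.
pose T := sup A.
have lT : l <= T by exact: (ub_le_sup ubA).
have Tt1 : T <= t1 by apply: ge_sup => [|t [/andP[]]//]; exists l.
have Tr : l <= T <= r by rewrite lT (le_trans Tt1).
have gT : g T <= 0.
  rewrite leNgt; apply/negP => gT.
  have [d d0 Hd] := cg T Tr _ gT.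
  have [s As Ts] := sup_adherent d0 supA.
  have sT : s <= T by exact: (ub_le_sup ubA).
  case: As => /andP[ls st1] gs.
  have := Hd s; rewrite ls (le_trans st1 t1r) => /(_ isT).
  rewrite distrC ger0_norm ?subr_ge0 // -/T in Ts *.
  move=> /(_ _)/wrap[]; first by lra.
  by rewrite ltr_norml => /andP[]; lra.
have Tlt : T < t1.
  by rewrite lt_neqAle Tt1 andbT; apply: contraTneq gt1 => <-; rewrite -leNgt.
have [d d0 Hd] : exists2 d, 0 < d &
    forall s, l <= s <= r -> T < s < T + d -> g s <= 0.
  have [gT0|gT0] := eqVneq (g T) 0.
    by apply: step => //; rewrite lT (lt_le_trans Tlt).
  have gT1 : 0 < - g T by rewrite oppr_gt0 lt_neqAle gT0.
  have [d d0 Hd] := cg T Tr _ gT1; exists d => // s ls /andP[Ts sT].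
  have := Hd s ls; rewrite ger0_norm ?subr_ge0 ?(ltW Ts) // => /(_ _)/wrap[]; first by lra.
  by rewrite ltr_norml => /andP[]; lra.
pose s := Num.min (T + d / 2) t1.
have sT : T < s by rewrite lt_min Tlt andbT ltrDl divr_gt0.
have st : s <= t1 by rewrite ge_min lexx orbT.
have sd : s < T + d by rewrite gt_min ltrD2l ltr_pdivrMr // ltr_pMr // ltr1n.
have As : A s.
  split; first by rewrite st (le_trans lT (ltW sT)).
  by apply: Hd; rewrite ?sT ?sd // (le_trans lT (ltW sT)) (le_trans st).
by have := ub_le_sup ubA As; rewrite leNgt sT.
Qed.

Lemma is_derive_neg_right (f : R -> R) (t df : R) : is_derive t 1 f df ->
  f t = 0 -> df < 0 -> exists2 d, 0 < d & forall s, t < s < t + d -> f s <= 0.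
Proof.
move=> [fd fE] ft0 df0.
have : h^-1 *: (f (h *: 1 + t) - f t) @[h --> 0^'] --> df.
  by rewrite -fE; exact: fd.
move=> /cvgrPdist_lt/(_ (- df)); rewrite oppr_gt0 => /(_ df0).
rewrite near_withinE => /nbhs_ballP[d /= d0 Hd]; exists d => // s /andP[ts sd].
have := Hd (s - t); rewrite /ball /= sub0r normrN ger0_norm ?subr_ge0 ?(ltW ts) //.
rewrite ltrBlDl => /(_ sd); rewrite subr_eq0 gt_eqF // => /(_ isT).
rewrite ft0 subr0 /GRing.scale /= mulr1 subrK.
rewrite ltr_norml => /andP[+ _]; rewrite opprK => H.
have {H} : (s - t)^-1 * f s < 0 by lra.
by rewrite pmulr_rlt0 ?invr_gt0 ?subr_gt0 // => /ltW.
Qed.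

Lemma continuous_modulus (f : R -> R) t : {for t, continuous f} ->
  forall eps, 0 < eps -> exists2 d, 0 < d &
    forall s, `|s - t| < d -> `|f s - f t| < eps.
Proof.
move=> /cvgrPdist_lt cf eps e0; have := cf eps e0.
rewrite near_simpl => /nbhs_ballP[d /= d0 Hd]; exists d => // s st.
by rewrite distrC; apply: Hd; rewrite /ball /= distrC.
Qed.

Lemma modulus_continuous (f : R -> R) :
  (forall t eps, 0 < eps -> exists2 d, 0 < d &
    forall s, `|s - t| < d -> `|f s - f t| < eps) -> continuous f.
Proof.
move=> H t; apply/cvgrPdist_lt => eps e0; have [d d0 Hd] := H t eps e0.
rewrite near_simpl; apply/nbhs_ballP; exists d => //= s.
by rewrite /ball /= distrC => /Hd; rewrite distrC.
Qed.

Lemma powR_root (p : nat) (x : R) : (0 < p)%N -> 0 <= x -> (x `^ p%:R^-1) ^+ p = x.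
Proof.
move=> p0 x0; rewrite -powR_mulrn ?powR_ge0 // -powRrM mulVf ?powRr1 //.
by rewrite pnatr_eq0 -lt0n.
Qed.

Lemma powR_rootX (p : nat) (x : R) : (0 < p)%N -> 0 <= x -> (x ^+ p) `^ p%:R^-1 = x.
Proof.
move=> p0 x0; rewrite -powR_mulrn // -powRrM mulfV ?powRr1 //.
by rewrite pnatr_eq0 -lt0n.
Qed.

Lemma exprn_superadd (p : nat) (a b : R) : (0 < p)%N -> 0 <= a -> 0 <= b ->
  a ^+ p + b ^+ p <= (a + b) ^+ p.
Proof.
case: p => // p _ a0 b0; elim: p => [|p IH]; first by rewrite !expr1.
rewrite [leRHS]exprS; apply: le_trans (ler_wpM2l (addr_ge0 a0 b0) IH).
rewrite mulrDr !mulrDl -!exprS.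
have := mulr_ge0 b0 (exprn_ge0 p.+1 a0); have := mulr_ge0 a0 (exprn_ge0 p.+1 b0).
by lra.
Qed.

(** Superadditivity of the power gives [|a - b| ^ p <= |a ^ p - b ^ p|] for nonnegative [a], [b],
    which covers the zeros of [f]; a speed may vanish. *)
Lemma continuous_root (p : nat) (f : R -> R) : (0 < p)%N -> (forall t, 0 <= f t) ->
  continuous f -> continuous (fun t => f t `^ p%:R^-1).
Proof.
move=> p0 f0 cf; apply: modulus_continuous => t eps e0.
have [d d0 Hd] := continuous_modulus (cf t) (exprn_gt0 p e0); exists d => // s /Hd.
have aux (a b : R) : 0 <= a -> 0 <= b -> `|a ^+ p - b ^+ p| < eps ^+ p -> b <= a -> `|a - b| < eps.
  move=> a0 b0 H ba; rewrite ger0_norm ?subr_ge0 //.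
  rewrite -(ltr_pXn2r p0) ?nnegrE ?subr_ge0 ?(ltW e0) //.
  apply: le_lt_trans H; rewrite (le_trans _ (ler_norm _)) // lerBrDl.
  by apply: le_trans (exprn_superadd p0 b0 _) _; rewrite ?subr_ge0 // subrKC.
rewrite -{1}(powR_root p0 (f0 s)) -{1}(powR_root p0 (f0 t)).
have a0 := powR_ge0 (f s) p%:R^-1; have b0 := powR_ge0 (f t) p%:R^-1.
move: a0 b0; set a := f s `^ _; set b := f t `^ _ => a0 b0 H.
have [ba|/ltW ab] := leP b a; first exact: aux.
by rewrite distrC; apply: aux => //; rewrite distrC.
Qed.

Lemma is_derive_bigsum (I : Type) (r : seq I) (F : I -> R -> R) (dF : I -> R) (t : R) :
  (forall i, is_derive t 1 (F i) (dF i)) ->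
  is_derive t 1 (fun s => \sum_(i <- r) F i s) (\sum_(i <- r) dF i).
Proof.
move=> HF; elim: r => [|i r IH].
  rewrite big_nil (_ : (fun _ => _) = cst 0); first exact: is_derive_cst.
  by apply/funext => s; rewrite big_nil.
rewrite big_cons (_ : (fun _ => _) = F i + (fun s => \sum_(i <- r) F i s)).
  exact: is_deriveD.
by apply/funext => s; rewrite big_cons.
Qed.

Lemma is_derive_affineD (F : R -> R) (t a e l dF : R) : is_derive t 1 F dF ->
  is_derive t 1 (fun s => a + F s + e * (1 + (s - l))) (dF + e).
Proof.
move=> DF; have -> : (fun s => a + F s + e * (1 + (s - l))) =
    F + (e \*: id + cst (a + e * (1 - l))).
  apply/funext => s.
  suff : a + F s + e * (1 + (s - l)) = F s + (e * s + (a + e * (1 - l))) by [].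
  by ring.
have De : is_derive t 1 (e \*: id) e.
  by have := is_deriveZ e (is_derive_id t (1 : R)); rewrite /GRing.scale /= mulr1.
have := is_deriveD DF (is_deriveD De (is_derive_cst (a + e * (1 - l)) t 1)).
by rewrite addr0.
Qed.

Lemma is_derive_affineB (F G H : R -> R) (t a k dF dG dH : R) :
  is_derive t 1 F dF -> is_derive t 1 G dG -> is_derive t 1 H dH ->
  is_derive t 1 (fun s => a + F s + k * G s - H s) (dF + k * dG - dH).
Proof.
move=> DF DG DH; have -> : (fun s => a + F s + k * G s - H s) =
    (cst a + F) + k \*: G - H by apply/funext => s; rewrite !fctE.
have := is_deriveB (is_deriveD (is_deriveD (is_derive_cst a t 1) DF) (is_deriveZ k DG)) DH.
by rewrite add0r.
Qed.

Lemma cvg_bigsum (T I : Type) (F : set_system T) (r : seq I) (f : I -> T -> R)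
    (l : I -> R) : Filter F -> (forall i, f i t @[t --> F] --> l i) ->
  (\sum_(i <- r) f i t) @[t --> F] --> \sum_(i <- r) l i.
Proof.
move=> FF Hf; elim: r => [|i r IH].
  rewrite big_nil (_ : (fun _ => _) = cst 0); first exact: cvg_cst.
  by apply/funext => t; rewrite big_nil.
rewrite big_cons (_ : (fun _ => _) = (fun t => f i t + \sum_(i <- r) f i t)).
  by apply: cvgD; [exact: Hf|exact: IH].
by apply/funext => t; rewrite big_cons.
Qed.

Local Notation mu := (@lebesgue_measure R).

Lemma continuous_itv_integrable (f : R -> R) (a b : R) : continuous f ->
  mu.-integrable `[a, b] (EFin \o f).
Proof.
move=> cf; apply: continuous_compact_integrable; first exact: segment_compact.
exact: continuous_subspaceT.
Qed.

Lemma continuous_primitive (f : R -> R) (l : R) : continuous f ->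
  exists F : R -> R, (forall t, l <= t -> is_derive t 1 F (f t)) /\
    (forall t, l <= t -> F t = Rintegral mu `[l, t] f).
Proof.
(* Integrating from [l - 1] makes [l] an interior point, so the two-sided derivative exists there as
   well. *)
move=> cf; pose G (t : R) := Rintegral mu `[l - 1, t] f.
have itf a b := @continuous_itv_integrable f a b cf.
exists (fun t => G t - G l); split => [t lt|t lt].
  have [||dG EG] := @continuous_FTC1_closed R f (l - 1) t (t + 1) _ (itf _ _) _ (cf t).
  - by rewrite ltrDl.
  - by rewrite ltrBlDr (le_lt_trans lt) // ltrDl.
  have -> : f t = f t - 0 by rewrite subr0.
  apply: is_deriveB; rewrite -EG derive1E; exact: derivableP.
rewrite /G Rintegral_itvB ?bnd_simp //; last by rewrite lerBlDr lerDl.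
apply: Rintegral_itv_obnd_cbnd.
by apply: integrableS (itf l t) => //; exact: subset_itv_oc_cc.
Qed.

End Barrier.

(** * No curve is shorter than the angle formula predicts *)

Section PathLength.
Context {R : realType} {n : nat}.
Local Notation C := R[i].
Local Notation cRe := (@complex.Re R).
Local Notation cIm := (@complex.Im R).
Local Notation mu := (@lebesgue_measure R).
Implicit Types (b : R -> 'M[C]_n) (p : nat) (t eps d : R).

(** Entrywise in real and imaginary parts, the form in which [closed_in_unitary] expects a limit. *)
Definition cvg_mx (T : Type) (F : set_system T) (X : T -> 'M[C]_n) (w : 'M[C]_n) :=
  forall i j, (fun z => cRe (X z i j)) @ F --> cRe (w i j) /\
              (fun z => cIm (X z i j)) @ F --> cIm (w i j).

Lemma cvg_mxM (T : Type) (F : set_system T) {FF : Filter F} (X Y : T -> 'M[C]_n) v w :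
  cvg_mx F X v -> cvg_mx F Y w -> cvg_mx F (fun z => X z *m Y z) (v *m w).
Proof.
move=> cX cY i j; rewrite mxE cRe_sum cIm_sum; split.
- rewrite (_ : (fun _ => _) = (fun z => \sum_k (cRe (X z i k) * cRe (Y z k j)
      - cIm (X z i k) * cIm (Y z k j)))); last first.
    by apply/funext => z; rewrite mxE cRe_sum; apply: eq_bigr => k _; rewrite cReM.
  apply: cvg_bigsum => k; have [xr xi] := cX i k; have [yr yi] := cY k j.
  by rewrite cReM; apply: cvgB; apply: cvgM.
- rewrite (_ : (fun _ => _) = (fun z => \sum_k (cRe (X z i k) * cIm (Y z k j)
      + cIm (X z i k) * cRe (Y z k j)))); last first.
    by apply/funext => z; rewrite mxE cIm_sum; apply: eq_bigr => k _; rewrite cImM.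
  apply: cvg_bigsum => k; have [xr xi] := cX i k; have [yr yi] := cY k j.
  by rewrite cImM; apply: cvgD; apply: cvgM.
Qed.

Lemma cvg_mx_adj (T : Type) (F : set_system T) {FF : Filter F} (X : T -> 'M[C]_n) w :
  cvg_mx F X w -> cvg_mx F (fun z => adjmx (X z)) (adjmx w).
Proof.
move=> cX i j; have [cr ci] := cX j i; rewrite adjmxE cRe_conj cIm_conj; split.
- by rewrite (_ : (fun _ => _) = (fun z => cRe (X z j i))) //;
    apply/funext => z; rewrite adjmxE cRe_conj.
- rewrite (_ : (fun _ => _) = (fun z => - cIm (X z j i))); first exact: cvgN.
  by apply/funext => z; rewrite adjmxE cIm_conj.
Qed.

Lemma cvg_mxX (T : Type) (F : set_system T) {FF : Filter F} (X : T -> 'M[C]_n) w k :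
  cvg_mx F X w -> cvg_mx F (fun z => X z ^+ k) (w ^+ k).
Proof.
move=> cX; elim: k => [|k IH].
  by move=> i j; split; exact: cvg_cst.
rewrite (_ : (fun _ => _) = (fun z => X z *m X z ^+ k)).
  by rewrite exprS; exact: cvg_mxM.
by apply/funext => z; rewrite exprS.
Qed.

Lemma continuous_schatten p b : (0 < p)%N -> C1mx b ->
  continuous (fun t => schatten p (mxderive b t)).
Proof.
move=> p0 Cb.
have cb t : cvg_mx (nbhs t) (mxderive b) (mxderive b t).
  move=> i j; have [_ [cr [_ ci]]] := Cb i j; split.
  - rewrite (_ : (fun _ => _) = (reC b i j)^`()); last by apply/funext => s; rewrite mxE.
    by rewrite mxE; exact: cr.
  - rewrite (_ : (fun _ => _) = (imC b i j)^`()); last by apply/funext => s; rewrite mxE.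
    by rewrite mxE; exact: ci.
apply: (@continuous_root R p (fun t => schpow p (mxderive b t))) => //.
  by move=> t; exact: schpow_ge0.
rewrite /schpow (_ : (fun _ => _) = (fun t => \sum_i
   cRe (((adjmx (mxderive b t) *m mxderive b t) ^+ p./2) i i))); last first.
  by apply/funext => t; rewrite /mxtrace cRe_sum.
move=> t; apply: cvg_bigsum => i.
have FF : Filter (nbhs t) by exact: nbhs_filter.
by have [] := @cvg_mxX _ _ FF _ _ p./2 (cvg_mxM (cvg_mx_adj (cb t)) (cb t)) i i.
Qed.

Lemma is_derive_reC b t (i j : 'I_n) : C1mx b ->
  is_derive t 1 (reC b i j) (cRe (mxderive b t i j)).
Proof.
move=> /(_ i j)[d _]; rewrite mxE /= derive1E; exact: derivableP.
Qed.

Lemma is_derive_imC b t (i j : 'I_n) : C1mx b ->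
  is_derive t 1 (imC b i j) (cIm (mxderive b t i j)).
Proof.
move=> /(_ i j)[_ [_ [d _]]]; rewrite mxE /= derive1E; exact: derivableP.
Qed.

Lemma Im_mxtraceM (K x : 'M[C]_n) : cIm (\tr (K *m x)) =
  \sum_i \sum_j (cRe (K i j) * cIm (x j i) + cIm (K i j) * cRe (x j i)).
Proof.
rewrite /mxtrace cIm_sum; apply: eq_bigr => i _; rewrite mxE cIm_sum.
by apply: eq_bigr => j _; rewrite cImM.
Qed.

Lemma is_derive_Im_mxtrace b (K : 'M[C]_n) t : C1mx b ->
  is_derive t 1 (fun s => cIm (\tr (K *m b s))) (cIm (\tr (K *m mxderive b t))).
Proof.
move=> Cb; rewrite (_ : (fun _ => _) = (fun s => \sum_i \sum_j
   (cRe (K i j) * imC b j i s + cIm (K i j) * reC b j i s))); last first.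
  by apply/funext => s; rewrite Im_mxtraceM.
rewrite Im_mxtraceM; apply: is_derive_bigsum => i; apply: is_derive_bigsum => j.
have Dr := is_derive_reC t j i Cb; have Di := is_derive_imC t j i Cb.
exact: (is_deriveD (is_deriveZ (cRe (K i j)) Di) (is_deriveZ (cIm (K i j)) Dr)).
Qed.

Lemma is_derive_frosq b t : C1mx b -> is_derive t 1 (fun s => frosq (b s - b t)) 0.
Proof.
move=> Cb; rewrite (_ : (fun _ => _) = (fun s => \sum_i \sum_j
   ((reC b i j s - reC b i j t) ^+ 2 + (imC b i j s - imC b i j t) ^+ 2))); last first.
  apply/funext => s; apply: eq_bigr => i _; apply: eq_bigr => j _.
  by rewrite !mxE /nsq cReB cImB.
rewrite -[X in is_derive _ _ _ X](_ : \sum_(i < n) \sum_(j < n) (0 : R) = 0); last first.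
  by rewrite big1 // => i _; rewrite big1.
apply: is_derive_bigsum => i; apply: is_derive_bigsum => j.
have Dr := is_derive_reC t i j Cb; have Di := is_derive_imC t i j Cb.
have sq (f : R -> R) (df : R) : is_derive t 1 f df ->
    is_derive t 1 (fun s => (f s - f t) ^+ 2) 0.
  move=> Df; rewrite (_ : (fun _ => _) = (f - cst (f t)) ^+ 2).
    by apply: is_derive_eq; rewrite /GRing.scale /= !fctE subrr; ring.
  by apply/funext => s.
by rewrite -[X in is_derive _ _ _ X]addr0; exact: (is_deriveD (sq _ _ Dr) (sq _ _ Di)).
Qed.

Lemma frosq0 : frosq (0 : 'M[C]_n) = 0.
Proof.
by rewrite /frosq big1 // => i _; rewrite big1 // => j _; rewrite mxE /nsq /= expr0n addr0.
Qed.

Lemma frosq_unitaryl (c x : 'M[C]_n) : unitary R n c -> frosq (c *m x) = frosq x.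
Proof.
move=> uc; rewrite !frosqE adjmxM -mulmxA (mulmxA (adjmx c)).
by rewrite (unitary_mulVmx uc) mul1mx.
Qed.

Definition specdist p (w : 'M[C]_n) : R := specpow p w `^ p%:R^-1.

Lemma specdistX p w : (0 < p)%N -> ~~ odd p -> unitary R n w ->
  specdist p w ^+ p = specpow p w.
Proof. by move=> p0 ep uw; rewrite powR_root // specpow_ge0. Qed.

Lemma specdist_ge0 p w : 0 <= specdist p w.
Proof. exact: powR_ge0. Qed.

Lemma specpow_continuous_path p c b l r : ~~ odd p -> unitary R n c -> C1mx b ->
  (forall t, l <= t <= r -> unitary R n (b t)) ->
  forall t, l <= t <= r -> forall eps, 0 < eps -> exists2 d, 0 < d &
    forall s, l <= s <= r -> `|s - t| < d ->
      `|specpow p (c *m b s) - specpow p (c *m b t)| < eps.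
Proof.
move=> ep uc Cb ub t lt eps e0.
have [K K0 HK] := @specpow_modulus R n p (eps / 2) ep (divr_gt0 e0 (ltr0n _ 2)).
have cf : {for t, continuous (fun s => frosq (b s - b t))}.
  by apply/differentiable_continuous/derivable1_diffP; case: (is_derive_frosq t Cb).
(* [K] may be 0, hence the divisor [K + 1]. *)
have e1 : 0 < eps / 2 / (K + 1) by rewrite !divr_gt0 // ltr_wpDl.
have [d d0 Hd] := continuous_modulus cf e1.
exists d => // s ls /Hd.
have -> : frosq (b t - b t) = 0 by rewrite subrr frosq0.
rewrite subr0 ger0_norm ?frosq_ge0 // => fd.
have := HK (c *m b s) (c *m b t) (unitary_mul uc (ub s ls)) (unitary_mul uc (ub t lt)).
rewrite -mulmxBr frosq_unitaryl // => H; apply: le_lt_trans H _.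
have : K * frosq (b s - b t) < eps / 2; last by lra.
apply: (@le_lt_trans _ _ ((K + 1) * frosq (b s - b t))).
  by rewrite ler_wpM2r ?frosq_ge0 // lerDl.
by move: fd; rewrite ltr_pdivlMr ?ltr_wpDl // mulrC.
Qed.

(** [specpow] along the curve is compared with [S ^ p] for a barrier [S] slightly above the claimed
    bound. At a time of equality [specpow_upper] gives a differentiable majorant, and [pow_grad_le]
    makes its slope smaller than that of [S ^ p]. *)
Lemma specdist_piece p c b l r : (2 <= p)%N -> ~~ odd p -> unitary R n c -> C1mx b ->
  l <= r -> (forall t, l <= t <= r -> unitary R n (b t)) ->
  specdist p (c *m b r) <= specdist p (c *m b l)
    + Rintegral mu `[l, r] (fun t => schatten p (mxderive b t)).
Proof.
move=> p2 ep uc Cb lr ub; have p0 : (0 < p)%N by apply: leq_trans p2.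
set N := fun t => schatten p (mxderive b t).
have N0 t : 0 <= N t by exact: powR_ge0.
have NX t : N t ^+ p = schpow p (mxderive b t) by rewrite powR_root // schpow_ge0.
have [F [dF FE]] := continuous_primitive l (continuous_schatten p0 Cb).
have F0 t : l <= t -> 0 <= F t by move=> lt; rewrite FE //; apply: Rintegral_ge0 => x _; exact: N0.
rewrite -FE //; set D0 := specdist p (c *m b l).
have ucb t : l <= t <= r -> unitary R n (c *m b t) by move=> lt; apply: unitary_mul (ub t lt).
suff main eps : 0 < eps -> specdist p (c *m b r) <= D0 + F r + eps * (1 + (r - l)).
  apply/ler_addgt0Pr => eps e0.
  have q : 0 < 1 + (r - l) by rewrite ltr_wpDr // subr_ge0.
  by have := main (eps / (1 + (r - l))) (divr_gt0 e0 q); rewrite divfK ?gt_eqF.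
(* The part [eps * 1] makes [S] positive, as [pow_grad_le] requires; the part [eps * (t - l)] makes
   its slope exceed [N t] strictly. *)
move=> e0; pose S (t : R) := D0 + F t + eps * (1 + (t - l)).
have S0 t : l <= t -> 0 < S t.
  move=> lt; rewrite /S ltr_wpDl ?addr_ge0 ?F0 ?specdist_ge0 //.
  by rewrite mulr_gt0 // ltr_wpDr // subr_ge0.
have dS t : l <= t -> is_derive t 1 S (N t + eps).
  move=> lt; have D1 : is_derive t 1 F (N t) := dF t lt.
  exact: is_derive_affineD.
have dSX t : l <= t -> is_derive t 1 (fun s => S s ^+ p) (p%:R * S t ^+ p.-1 * (N t + eps)).
  move=> lt; have D1 := dS t lt.
  rewrite (_ : (fun _ => _) = S ^+ p); last by apply/funext => s; rewrite fctE.
  by apply: is_derive_eq; rewrite /GRing.scale /= mulr_natl.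
rewrite -/(S r) -(ler_pXn2r p0) ?nnegrE ?specdist_ge0 ?(ltW (S0 _ _)) //.
rewrite specdistX //; last by apply: ucb; rewrite lr lexx.
rewrite -subr_le0.
have [K K0 HK] := @specpow_upper R n p ep.
apply: (@le0_barrier R (fun t => specpow p (c *m b t) - S t ^+ p) l r); last by rewrite lr lexx.
- move=> t lt eps1 e1; have l1 : l <= t by case/andP: lt.
  have e2 : 0 < eps1 / 2 by rewrite divr_gt0.
  have [d1 d10 H1] := specpow_continuous_path ep uc Cb ub lt e2.
  have /differentiable_continuous : differentiable (fun s => S s ^+ p) t.
    by apply/derivable1_diffP; case: (dSX t l1).
  move=> /cvgrPdist_lt/(_ _ e2); rewrite near_simpl => /nbhs_ballP[d2 /= d20 H2].
  exists (Num.min d1 d2) => [|s ls]; first by rewrite lt_min d10.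
  rewrite lt_min => /andP[/(H1 s ls) a1 st].
  have := H2 s; rewrite /ball /= distrC => /(_ st) a2.
  rewrite opprB [S t ^+ p - _]addrC addrACA [- _ + S t ^+ p]addrC.
  by rewrite (splitr eps1) (le_lt_trans (ler_normD _ _)) // ltrD.
- rewrite -specdistX //; last by apply: ucb; rewrite lexx.
  rewrite subr_le0 lerXn2r ?nnegrE ?specdist_ge0 ?(ltW (S0 _ _)) //.
  by rewrite /S subrr addr0 mulr1 -addrA lerDl addr_ge0 ?F0 // ltW.
move=> t /andP[l1 tr] /eqP; rewrite subr_eq0 => /eqP hS.
have lt : l <= t <= r by rewrite l1 ltW.
have [V uV [th hth Ew]] := unitary_sdec (ucb t lt).
pose G := pow_grad p V th *m adjmx (c *m b t) *m c.
(* Majorant of the gap, with equality at [t]. The quadratic error has derivative 0 at [t], so only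
   the linear term and [S ^ p] enter [drho]. *)
pose rho (s : R) := S t ^+ p + cIm (\tr (G *m b s)) + K * frosq (b s - b t) - S s ^+ p.
have grho s : l <= s <= r -> specpow p (c *m b s) - S s ^+ p <= rho s.
  move=> ls; rewrite /rho lerD2r -hS -(frosq_unitaryl (b s - b t) uc) mulmxBr.
  by rewrite /G -mulmxA; apply: (HK V th) => //; exact: ucb.
have rho0 : rho t = 0.
  rewrite /rho subrr frosq0; have -> : G *m b t = pow_grad p V th.
    rewrite /G -(mulmxA _ c) -(mulmxA (pow_grad p V th)).
    by rewrite (unitary_mulVmx (ucb t lt)) mulmx1.
  rewrite mxtrace_sdec // cIm_sum.
  by rewrite big1 // mulr0 !addr0 subrr.
pose drho := cIm (\tr (G *m mxderive b t)) - p%:R * S t ^+ p.-1 * (N t + eps).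
have Drho : is_derive t 1 rho drho.
  have D1 := is_derive_Im_mxtrace G t Cb; have D2 := is_derive_frosq t Cb.
  have D3 := dSX t l1.
  have := is_derive_affineB (S t ^+ p) K D1 D2 D3.
  by rewrite mulr0 addr0.
have drho0 : drho < 0.
  (* [N t] may vanish; half of [eps] makes the Hoelder bound positive and keeps it below the slope
     [N t + eps]. *)
  have N1 : 0 < N t + eps / 2 by rewrite ltr_wpDl // divr_gt0.
  have := @pow_grad_le R n p V th (c *m mxderive b t) (S t) (N t + eps / 2)
    p0 ep uV (S0 _ l1) N1; rewrite -Ew => /(_ _ _)/wrap[].
    by rewrite -hS Ew specpowE.
    rewrite -[c *m _]mulmx1 schpow_unitary_conj //; last exact: unitary1.
    rewrite -NX lerXn2r ?nnegrE ?N0 ?(ltW N1) //.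
    by rewrite lerDl ltW // divr_gt0.
  rewrite mulmxA -/G => /le_lt_trans; rewrite /drho subr_lt0; apply.
  by rewrite -mulrA ltr_pM2l ?ltr0n // ltr_pM2l ?exprn_gt0 ?S0 // ltrD2l; lra.
have [d d0 Hd] := is_derive_neg_right Drho rho0 drho0.
by exists d => // s ls /Hd; apply: le_trans; exact: grho.
Qed.

Lemma pw_path_specdist p c (a : R -> 'M[C]_n) s (b : nat -> R -> 'M[C]_n) : (2 <= p)%N -> ~~ odd p ->
  unitary R n c -> pw_smooth_path (unitary R n) a s b ->
  specdist p (c *m a 1) <= specdist p (c *m a 0) + pw_length (@schatten R p n) s b.
Proof.
move=> p2 ep uc [ua [s1 [s0 [sl [ss Hp]]]]].
have sz : (0 < size s)%N by apply: ltn_trans s1.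
have mono i j : (i <= j < size s)%N -> nth 0 s i <= nth 0 s j.
  move=> /andP[ij js]; move: ij; rewrite leq_eqVlt => /predU1P[->//|ij].
  by apply: ltW; apply: (sorted_ltn_nth lt_trans) => //; rewrite inE // (ltn_trans ij).
have n0 : nth 0 s 0 = 0 by rewrite nth0.
have nl : nth 0 s (size s).-1 = 1 by rewrite nth_last.
have step k : (k <= (size s).-1)%N -> specdist p (c *m a (nth 0 s k)) <=
    specdist p (c *m a 0) + \sum_(i < k) Rintegral mu `[nth 0 s i, nth 0 s i.+1]
       (fun t => schatten p (mxderive (b i) t)).
  elim: k => [_|k IH ks]; first by rewrite big_ord0 addr0 n0.
  rewrite big_ord_recr /= addrA; have [Ck ak] := Hp k ks.
  have k1 : (k.+1 < size s)%N by rewrite -ltnS prednK in ks.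
  have kk : nth 0 s k <= nth 0 s k.+1 by apply: mono; rewrite leqnSn.
  rewrite (ak (nth 0 s k.+1)) ?kk ?lexx //.
  have := IH (ltnW ks); rewrite (ak (nth 0 s k)) ?kk ?lexx // => IHk.
  apply: le_trans (specdist_piece p2 ep uc Ck kk _) _; last by rewrite lerD2r.
  move=> t /andP[t1 t2]; rewrite -ak ?t1 //; apply: ua.
  rewrite -n0 -nl (le_trans _ t1) ?(le_trans t2) ?mono //=.
  - by rewrite ltn_predL sz andbT -ltnS prednK.
  - by rewrite (ltn_trans (ltnSn k)).
by rewrite -[in a 1]nl; exact: step.
Qed.

End PathLength.

(** * One-parameter groups, the formula for [dp], and the operator norm *)

Lemma Rintegral_cst01 (R : realType) (c:R) : Rintegral (@lebesgue_measure R) `[0,1] (fun=> c) = c.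
Proof.
have E : fine (@lebesgue_measure R `[0, 1]) = 1.
  by rewrite lebesgue_measure_itv /= lte_fin ltr01 oppr0 addr0.
have := @Rintegral_cst _ _ _ (@lebesgue_measure R) _ (measurable_itv `[0, 1]%R) c.
by rewrite E mulr1.
Qed.
Section SpectralPath.
Context {R : realType} {n : nat}.
Local Notation C := R[i].
Local Notation cRe := (@complex.Re R).
Local Notation cIm := (@complex.Im R).
Local Notation mu := (@lebesgue_measure R).
Implicit Types (x y u v w V U W : 'M[C]_n) (th et : 'I_n -> R) (p : nat) (t : R).

Definition spath u V th t : 'M[C]_n := u *m sdec V (expi \o (fun k => t * th k)).

Lemma spath0 u V th : unitary R n V -> spath u V th 0 = u.
Proof.
move=> uV; rewrite /spath (@eq_sdec _ _ V _ (fun=> 1)) ?sdec1 ?mulmx1 //.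
by move=> k; rewrite /comp mul0r expi0.
Qed.

Lemma spath1 u V th : spath u V th 1 = u *m sdec V (expi \o th).
Proof. by rewrite /spath; congr (_ *m _); apply: eq_sdec => k; rewrite /comp mul1r. Qed.

Lemma unitary_spath u V th t : unitary R n u -> unitary R n V ->
  unitary R n (spath u V th t).
Proof. by move=> uu uV; apply: unitary_mul => //; exact: sdec_expi_unitary. Qed.

Lemma mulmx_sdecE u V (f : 'I_n -> C) i j :
  (u *m sdec V f) i j = \sum_k (u *m V) i k * conjc (V j k) * f k.
Proof.
rewrite /sdec !mulmxA mxE; apply: eq_bigr => k _.
by rewrite mul_mx_diag adjmxE [in LHS]mxE [X in _ * X * _]mxE mulrAC.
Qed.

Lemma is_derive_trig (a b s t : R) : is_derive t 1
  (fun r => a * cos (r * s) + b * sin (r * s)) (a * (- sin (t * s) * s) + b * (cos (t * s) * s)).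
Proof.
have Dl : is_derive t 1 (fun r : R => r * s) s.
  have -> : (fun r : R => r * s) = s \*: id by apply/funext => r; rewrite mulrC.
  by have := is_deriveZ s (is_derive_id t (1 : R)); rewrite /GRing.scale /= mulr1.
have Dc := @is_derive1_comp R cos (fun r => r * s) t _ _ (is_derive_cos (t * s)) Dl.
have Ds := @is_derive1_comp R sin (fun r => r * s) t _ _ (is_derive_sin (t * s)) Dl.
exact: (is_deriveD (is_deriveZ a Dc) (is_deriveZ b Ds)).
Qed.

Lemma spath_C1_derive u V th : C1mx (spath u V th) /\
  forall t, mxderive (spath u V th) t =
    u *m sdec V (fun k => Complex 0 (th k) * expi (t * th k)).
Proof.
pose a i j k := (u *m V) i k * conjc (V j k).
have rE i j : reC (spath u V th) i j = (fun t => \sum_k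
    (cRe (a i j k) * cos (t * th k) + (- cIm (a i j k)) * sin (t * th k))).
  apply/funext => t; rewrite /reC /spath mulmx_sdecE cRe_sum; apply: eq_bigr => k _.
  by rewrite -/(a i j k) cReM /= mulNr.
have iE i j : imC (spath u V th) i j = (fun t => \sum_k
    (cIm (a i j k) * cos (t * th k) + cRe (a i j k) * sin (t * th k))).
  apply/funext => t; rewrite /imC /spath mulmx_sdecE cIm_sum; apply: eq_bigr => k _.
  by rewrite -/(a i j k) cImM /= addrC.
have Dr i j t := is_derive_bigsum (index_enum 'I_n)
   (fun k => is_derive_trig (cRe (a i j k)) (- cIm (a i j k)) (th k) t).
have Di i j t := is_derive_bigsum (index_enum 'I_n)
   (fun k => is_derive_trig (cIm (a i j k)) (cRe (a i j k)) (th k) t).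
have trigc (c d s : R) : continuous
    (fun t => c * (- sin (t * s) * s) + d * (cos (t * s) * s)).
  have -> : (fun t => c * (- sin (t * s) * s) + d * (cos (t * s) * s)) =
     (fun r => (d * s) * cos (r * s) + (- c * s) * sin (r * s)).
    by apply/funext => t; ring.
  exact: is_derive_continuous (fun t => is_derive_trig (d * s) (- c * s) s t).
have d1 (f df : R -> R) : (forall t, is_derive t 1 f (df t)) -> f^`() = df.
  by move=> D; apply/funext => t; rewrite derive1E; case: (D t).
split=> [i j|t].
  rewrite rE iE; split; first by move=> t; case: (Dr i j t).
  split; first by rewrite (d1 _ _ (Dr i j)); move=> t; apply: cvg_bigsum => k; exact: trigc.
  split; first by move=> t; case: (Di i j t).
  by rewrite (d1 _ _ (Di i j)); move=> t; apply: cvg_bigsum => k; exact: trigc.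
apply/matrixP => i j; rewrite mxE rE iE (d1 _ _ (Dr i j)) (d1 _ _ (Di i j)).
rewrite mulmx_sdecE; apply: complex_eqP; rewrite ?cRe_sum ?cIm_sum /=;
  apply: eq_bigr => k _; rewrite -/(a i j k) !(cReM, cImM) /=; ring.
Qed.

(** The factor [i] is absorbed as the angle [pi / 2]. The velocity is then a unitary matrix times a
    constant one, so every left unitarily invariant norm has constant speed. *)
Lemma mxderive_spath u V th t : unitary R n V -> mxderive (spath u V th) t =
  (u *m sdec V (expi \o (fun k => t * th k + pi / 2))) *m sdec V (fun k => (th k)%:C%C).
Proof.
move=> uV; rewrite (spath_C1_derive u V th).2 -(mulmxA u) (sdecM _ _ uV).
congr (_ *m _); apply: eq_sdec => k; rewrite /comp.
apply: complex_eqP; rewrite !(cReM, cImM) /= ?cosDpihalf ?sinDpihalf; ring.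
Qed.

Lemma pw_path_spath u V th : unitary R n u -> unitary R n V ->
  pw_smooth_path (unitary R n) (spath u V th) [:: 0; 1] (fun=> spath u V th).
Proof.
move=> uu uV; split; first by move=> t _; exact: unitary_spath.
do 3 (split => //); split; first by rewrite /= ltr01.
by move=> i _; split => //; exact: (spath_C1_derive u V th).1.
Qed.

Lemma pw_length_spath (N : 'M[C]_n -> R) u V th :
  unitary R n u -> unitary R n V ->
  (forall W x, unitary R n W -> N (W *m x) = N x) ->
  pw_length N [:: 0; 1] (fun=> spath u V th) = N (sdec V (fun k => (th k)%:C%C)).
Proof.
move=> uu uV HN; rewrite /pw_length /= big_ord_recl big_ord0 addr0 /=.
have -> : Rintegral mu `[0, 1] (fun t => N (mxderive (spath u V th) t)) =
    Rintegral mu `[0, 1] (fun=> N (sdec V (fun k => (th k)%:C%C))).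
  apply: eq_Rintegral => t _; rewrite mxderive_spath // HN //.
  by apply: unitary_mul => //; exact: sdec_expi_unitary.
exact: Rintegral_cst01.
Qed.

Lemma schatten_unitaryl p W x : unitary R n W -> schatten p (W *m x) = schatten p x.
Proof.
move=> uW; have := @schpow_unitary_conj R n p x W 1%:M uW unitary1.
by rewrite mulmx1 /schpow /schatten => ->.
Qed.

Lemma schpow_sdec p V th : ~~ odd p -> unitary R n V ->
  schpow p (sdec V (fun k => (th k)%:C%C)) = \sum_k th k ^+ p.
Proof.
move=> ep uV; rewrite /schpow sdec_adj sdecM // sdecX // mxtrace_sdec // cRe_sum.
apply: eq_bigr => k _; rewrite conjc_real -rmorphM -rmorphXn /= -expr2 -exprM mul2n.
by rewrite -[in RHS](odd_double_half p) (negbTE ep).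
Qed.

Lemma dpE p u v : (2 <= p)%N -> ~~ odd p -> unitary R n u -> unitary R n v ->
  dp p u v = specdist p (adjmx u *m v).
Proof.
move=> p2 ep uu uv; have p0 : (0 < p)%N by apply: leq_trans p2.
rewrite /dp /mxdist; set A := (X in inf X).
have lbA : lbound A (specdist p (adjmx u *m v)).
  move=> L [a [s [b [Hp [a0 [a1 ->]]]]]].
  have := pw_path_specdist p2 ep (unitary_adj uu) Hp; rewrite a0 a1.
  rewrite (unitary_mulVmx uu) (_ : specdist p 1%:M = 0) ?add0r //.
  have -> : 1%:M = sdec 1%:M (expi \o (fun=> 0)) :> 'M[C]_n.
    rewrite (@eq_sdec _ _ _ _ (fun=> 1)) ?sdec1 //; first exact: unitary1.
    by move=> k; rewrite /comp expi0.
  rewrite /specdist specpowE //; last by move=> i; rewrite normr0 pi_ge0.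
    rewrite big1 ?powR0 ?invr_eq0 ?pnatr_eq0 -?lt0n // => i _.
    by rewrite expr0n gtn_eqF.
  exact: unitary1.
have [V uV [th hth E]] := unitary_sdec (unitary_mul (unitary_adj uu) uv).
have AD : A (specdist p (adjmx u *m v)).
  exists (spath u V th), [:: 0; 1], (fun=> spath u V th).
  split; first exact: pw_path_spath.
  rewrite spath0 // spath1 -E mulmxA (unitary_mulmxV uu) mul1mx; do 2 split => //.
  rewrite (pw_length_spath (N := @schatten R p n) th uu uV); last first.
    by move=> W x; exact: schatten_unitaryl.
  rewrite E /specdist specpowE // -(schpow_sdec th ep uV).
  by rewrite /schatten /schpow.
apply/eqP; rewrite eq_le; apply/andP; split.
  by apply: ge_inf AD; exists (specdist p (adjmx u *m v)).
by apply: lb_le_inf => //; exists (specdist p (adjmx u *m v)).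
Qed.

Lemma vnormE (v : 'cV[C]_n) : vnorm v = Num.sqrt (\sum_i nsq (v i 0)).
Proof. by rewrite /vnorm; congr Num.sqrt; apply: eq_bigr => i _; rewrite -nsqE. Qed.

Lemma sum_nsq_unitaryl W (v : 'cV[C]_n) : unitary R n W ->
  \sum_i nsq ((W *m v) i 0) = \sum_i nsq (v i 0).
Proof.
move=> uW; have E (z : 'cV[C]_n) :
    (\sum_i nsq (z i 0))%:C%C = ((map_mx (@conjc R) z)^T *m z) 0 0.
  rewrite rmorph_sum mxE; apply: eq_bigr => i _.
  by rewrite !mxE mulrC -nsqE.
apply: (@complexI R); rewrite !E map_mxM trmx_mul -/(adjmx W) -mulmxA (mulmxA (adjmx W)).
by rewrite (unitary_mulVmx uW) mul1mx.
Qed.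

Lemma vnorm_unitaryl W (v : 'cV[C]_n) : unitary R n W -> vnorm (W *m v) = vnorm v.
Proof. by move=> uW; rewrite !vnormE sum_nsq_unitaryl. Qed.

Lemma opnorm_unitaryl W x : unitary R n W -> opnorm (W *m x) = opnorm x.
Proof.
move=> uW; rewrite /opnorm; congr sup; apply/seteqP.
by split=> r [v v1 <-]; exists v => //; rewrite -mulmxA (vnorm_unitaryl (x *m v) uW).
Qed.

Lemma vnorm_sdec_le V (f : 'I_n -> C) (B : R) (v0 : 'cV[C]_n) : unitary R n V -> 0 <= B ->
  (forall k, nsq (f k) <= B ^+ 2) -> vnorm (sdec V f *m v0) <= B * vnorm v0.
Proof.
move=> uV B0 fB; rewrite /sdec -!mulmxA vnorm_unitaryl //.
rewrite -[in leRHS](vnorm_unitaryl v0 (unitary_adj uV)).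
move: (adjmx V *m v0) => z; rewrite !vnormE -[B in leRHS]ger0_norm // -sqrtr_sqr.
rewrite -sqrtrM ?sqr_ge0 // ler_wsqrtr // mulr_sumr; apply: ler_sum => k _.
have -> : (diag_mx (\row_i f i) *m z) k 0 = f k * z k 0.
  by rewrite mul_diag_mx mxE [X in X * _]mxE.
have -> : nsq (f k * z k 0) = nsq (f k) * nsq (z k 0).
  by rewrite /nsq cReM cImM; ring.
by rewrite ler_wpM2r ?nsq_ge0.
Qed.

Lemma opnorm_sdec_le V (f : 'I_n -> C) (B : R) : unitary R n V -> 0 <= B ->
  (forall k, nsq (f k) <= B ^+ 2) -> opnorm (sdec V f) <= B.
Proof.
move=> uV B0 fB; rewrite /opnorm; set A := (X in sup X).
(* For [n = 0] there are no unit vectors and [sup] takes its value 0 on the empty set. *)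
have [->|A0] := eqVneq A set0; first by rewrite sup0.
apply: ge_sup; first exact/set0P.
by move=> r [v0 v1 <-]; rewrite (le_trans (vnorm_sdec_le _ uV B0 fB)) // v1 mulr1.
Qed.

(** The [k]-th column of [V] is a unit eigenvector attaining the bound; [B] only certifies that the
    supremum is over a bounded set. *)
Lemma opnorm_sdec_ge V (f : 'I_n -> C) k : unitary R n V ->
  nsq (f k) <= opnorm (sdec V f) ^+ 2.
Proof.
move=> uV; pose B := Num.sqrt (\sum_i nsq (f i)).
have fB i : nsq (f i) <= B ^+ 2.
  rewrite sqr_sqrtr; last by apply: sumr_ge0 => j _; exact: nsq_ge0.
  by rewrite (bigD1 i) //= lerDl sumr_ge0 // => j _; exact: nsq_ge0.
pose v0 : 'cV[C]_n := V *m delta_mx k 0.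
have deltaE (a : C) : \sum_i nsq ((a *: delta_mx k 0 : 'cV[C]_n) i 0) = nsq a.
  rewrite (bigD1 k) //= big1 ?addr0; first by rewrite !mxE !eqxx mulr1.
  by move=> i /negbTE ik; rewrite !mxE ik mulr0 /nsq /= expr0n addr0.
have v1 : vnorm v0 = 1.
  by rewrite vnorm_unitaryl // vnormE -[delta_mx _ _]scale1r deltaE /nsq /= expr1n expr0n addr0 sqrtr1.
have Av : vnorm (sdec V f *m v0) = Num.sqrt (nsq (f k)).
  rewrite /sdec /v0 -!mulmxA vnorm_unitaryl // (mulmxA (adjmx V)) (unitary_mulVmx uV) mul1mx.
  rewrite vnormE; congr Num.sqrt; rewrite -(deltaE (f k)); apply: eq_bigr => i _.
  rewrite mul_diag_mx mxE [X in X * _]mxE; congr nsq; rewrite [RHS]mxE mxE.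
  by case: (eqVneq i k) => [->//|_]; rewrite !mulr0.
rewrite -[leLHS]sqr_sqrtr ?nsq_ge0 // -Av lerXn2r ?nnegrE ?sqrtr_ge0 //.
  have : 0 <= vnorm (sdec V f *m v0) by exact: sqrtr_ge0.
  move=> /le_trans; apply; apply: ub_le_sup; last by exists v0.
  exists B => r [v2 v21 <-].
  by rewrite (le_trans (vnorm_sdec_le _ uV (sqrtr_ge0 _) fB)) // v21 mulr1.
apply: ub_le_sup; last by exists v0.
exists B => r [v2 v21 <-].
by rewrite (le_trans (vnorm_sdec_le _ uV (sqrtr_ge0 _) fB)) // v21 mulr1.
Qed.

Lemma opnorm_ge0 x : 0 <= opnorm x.
Proof.
rewrite /opnorm; set A := (X in sup X).
have [hs|/sup_out -> //] := pselect (has_sup A); have [[r Ar] ubA] := hs.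
by apply: le_trans (ub_le_sup ubA Ar); case: Ar => v _ <-; exact: sqrtr_ge0.
Qed.

(** Finitely many strict bounds give a uniform one, so that strictness survives the suprema and
    infima in [opnorm] and [dinf]. *)
Lemma angle_bound th (c : R) : 0 < c -> (forall i, `|th i| < c) ->
  exists2 B : R, 0 <= B < c & forall i, `|th i| <= B.
Proof.
move=> c0 H; exists (\big[Num.max/0]_i `|th i|); last by move=> i; exact: le_bigmax.
by rewrite bigmax_lt // andbT; exact: bigmax_ge_id.
Qed.

Lemma dinf_lt_pi u v V th : unitary R n u -> unitary R n v -> unitary R n V ->
  (forall i, `|th i| < pi) -> adjmx u *m v = sdec V (expi \o th) -> dinf u v < pi.
Proof.
move=> uu uv uV hth E; have [B /andP[B0 Bpi] HB] := angle_bound (pi_gt0 R) hth.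
apply: le_lt_trans Bpi; rewrite /dinf /mxdist; set A := (X in inf X).
apply: (@le_trans _ _ (opnorm (sdec V (fun k => (th k)%:C%C)))).
  apply: ge_inf.
    exists 0 => L [a [s [b [_ [_ [_ ->]]]]]]; apply: sumr_ge0 => i _.
    by apply: Rintegral_ge0 => t _; exact: opnorm_ge0.
  exists (spath u V th), [:: 0; 1], (fun=> spath u V th).
  split; first exact: pw_path_spath.
  rewrite spath0 // spath1 -E mulmxA (unitary_mulmxV uu) mul1mx; do 2 split => //.
  rewrite (pw_length_spath (N := @opnorm R n) th uu uV); first by [].
  by move=> W x; exact: opnorm_unitaryl.
apply: opnorm_sdec_le => // k; rewrite /nsq /= expr0n addr0.
by rewrite -real_normK ?num_real // lerXn2r ?nnegrE.
Qed.

End SpectralPath.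

(** * Matrix exponential and logarithm in an eigenbasis *)

Section ExpLog.
Context {R : realType} {n : nat}.
Local Notation C := R[i].
Local Notation cRe := (@complex.Re R).
Local Notation cIm := (@complex.Im R).
Implicit Types (x y u v w V U W : 'M[C]_n) (th et : 'I_n -> R) (t : R).

(** The two parts are shaped to match [cos_coeff] and [sin_coeff]. *)
Lemma complex_iX (a : R) k : (Complex 0 a : C) ^+ k =
  Complex ((~~ odd k)%:R * (-1) ^+ k./2 * a ^+ k) ((odd k)%:R * (-1) ^+ k.-1./2 * a ^+ k).
Proof.
elim: k => [|k IH].
  by rewrite !expr0; apply: complex_eqP; rewrite /= ?mulr1 ?mul0r.
rewrite exprS IH; apply: complex_eqP; rewrite ?cReM ?cImM /= !exprS.
  case ok: (odd k) => /=; last by ring.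
  case: k ok {IH} => // k /= /negbTE ok; rewrite uphalf_half ok add0n !exprS; ring.
by case: (odd k) => /=; ring.
Qed.

Definition expi_partial (a : R) N : C := \sum_(k < N) (k`!)%:R^-1 * (Complex 0 a) ^+ k.

Lemma expi_partialE (a : R) N :
  expi_partial a N = Complex (series (cos_coeff a) N) (series (sin_coeff a) N).
Proof.
have invE (k : nat) : (k%:R^-1 : C) = ((k%:R^-1 : R)%:C)%C.
  by rewrite fmorphV rmorph_nat.
rewrite /series /= !big_mkord /expi_partial; apply: complex_eqP;
  rewrite ?cRe_sum ?cIm_sum /=; apply: eq_bigr => k _;
  rewrite complex_iX invE ?cReM ?cImM /= /cos_coeff /sin_coeff /= -?exprnP; ring.
Qed.

Lemma mxexp_sdec V et : unitary R n V ->
  mxexp (sdec V (fun k => Complex 0 (et k))) = sdec V (expi \o et).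
Proof.
move=> uV; pose y := sdec V (fun k => Complex 0 (et k)).
have yE N : \sum_(k < N) ((k`!)%:R^-1 *: y ^+ k) = sdec V (fun j => expi_partial (et j) N).
  apply/matrixP => i j; rewrite summxE sdecE.
  under eq_bigr => k _ do rewrite mxE sdecX // sdecE mulr_sumr.
  rewrite exchange_big /=; apply: eq_bigr => l _.
  rewrite /expi_partial mulr_sumr mulr_suml; apply: eq_bigr => k _ /=; ring.
have cc (a : R) : series (cos_coeff a) N @[N --> \oo] --> cos a.
  by rewrite unlock; exact: is_cvg_series_cos_coeff.
have cs (a : R) : series (sin_coeff a) N @[N --> \oo] --> sin a.
  by rewrite unlock; exact: is_cvg_series_sin_coeff.
apply/matrixP => i j; rewrite mxE sdecE.
pose a k := V i k * conjc (V j k).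
apply: complex_eqP => /=.
- rewrite cRe_sum; apply/cvg_lim => //.
  rewrite (_ : (fun _ => _) = (fun N => \sum_k (cRe (a k) * series (cos_coeff (et k)) N
      - cIm (a k) * series (sin_coeff (et k)) N))); last first.
    apply/funext => N; rewrite yE sdecE cRe_sum; apply: eq_bigr => k _.
    by rewrite mulrAC -/(a k) expi_partialE cReM.
  apply: cvg_trans (@cvg_bigsum _ _ _ _ (index_enum 'I_n) _
    (fun k => cRe (a k) * cos (et k) - cIm (a k) * sin (et k)) _ _) _.
    by move=> k; apply: cvgB; apply: cvgMr.
  rewrite (eq_bigr (fun k => cRe (V i k * (expi \o et) k * conjc (V j k)))) //.
  by move=> k _; rewrite [X in _ = cRe X]mulrAC -/(a k) [RHS]cReM.
- rewrite cIm_sum; apply/cvg_lim => //.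
  rewrite (_ : (fun _ => _) = (fun N => \sum_k (cRe (a k) * series (sin_coeff (et k)) N
      + cIm (a k) * series (cos_coeff (et k)) N))); last first.
    apply/funext => N; rewrite yE sdecE cIm_sum; apply: eq_bigr => k _.
    by rewrite mulrAC -/(a k) expi_partialE cImM.
  apply: cvg_trans (@cvg_bigsum _ _ _ _ (index_enum 'I_n) _
    (fun k => cRe (a k) * sin (et k) + cIm (a k) * cos (et k)) _ _) _.
    by move=> k; apply: cvgD; apply: cvgMr.
  rewrite (eq_bigr (fun k => cIm (V i k * (expi \o et) k * conjc (V j k)))) //.
  by move=> k _; rewrite [X in _ = cIm X]mulrAC -/(a k) [RHS]cImM.
Qed.

Lemma skewherm_sdec y : skewherm y ->
  exists2 V, unitary R n V & exists et, y = sdec V (fun k => Complex 0 (et k)).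
Proof.
move=> sy; have [|V uV [f E]] := @normal_sdec R n y.
  by rewrite (sy : adjmx y = - y) mulmxN mulNmx.
exists V => //; exists (fun k => cIm (f k)); rewrite {1}E; apply: eq_sdec => k.
have : adjmx y = - y by [].
rewrite E sdec_adj -scaleN1r sdecZ => /(sdec_inj uV)/(_ k)/(congr1 cRe).
rewrite cRe_conj mulN1r cReN => fk; apply: complex_eqP => //=; lra.
Qed.

Lemma sdec_imag_skewherm V et : skewherm (sdec V (fun k => Complex 0 (et k) : C)).
Proof.
rewrite /skewherm /= sdec_adj -scaleN1r sdecZ; apply: eq_sdec => k.
by apply: complex_eqP; rewrite mulN1r ?cReN ?cImN /= ?oppr0.
Qed.

(** The default value 0 is skew-Hermitian too, so every point of [geod] is [u] times the exponential
    of a skew-Hermitian matrix. *)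
Lemma mxlog_skewherm w : skewherm (mxlog w).
Proof.
rewrite /mxlog; case: xgetP => [y _ []//|_].
by rewrite /skewherm /= oppr0; apply/matrixP => i j; rewrite adjmxE !mxE conjc0.
Qed.

Lemma scale_sdec_imag t V et : (t%:C)%C *: sdec V (fun k => Complex 0 (et k) : C) =
  sdec V (fun k => Complex 0 (t * et k)).
Proof.
rewrite sdecZ; apply: eq_sdec => k.
by apply: complex_eqP; rewrite ?cReM ?cImM /=; ring.
Qed.

Lemma unitary_geod u v t : unitary R n u -> unitary R n (geod u v t).
Proof.
move=> uu; apply: unitary_mul => //.
have [V uV [et ->]] := skewherm_sdec (mxlog_skewherm (invmx u *m v)).
by rewrite scale_sdec_imag mxexp_sdec //; exact: sdec_expi_unitary.
Qed.

(** The chosen logarithm enters through its norm below [pi] and its exponential. Diagonalized in its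
    own basis [W], it has angles below [pi], and halving them gives a square root of
    [adjmx u *m v]. *)
Lemma geod_half u v V th : unitary R n u -> unitary R n v -> unitary R n V ->
  (forall i, `|th i| < pi) -> adjmx u *m v = sdec V (expi \o th) ->
  exists W et, [/\ unitary R n W, forall i, `|et i| < pi / 2,
    geod u v (1 / 2) = u *m sdec W (expi \o et)
    & sdec W (expi \o et) *m sdec W (expi \o et) = adjmx u *m v].
Proof.
move=> uu uv uV hth E.
have [B /andP[B0 Bpi] HB] := angle_bound (pi_gt0 R) hth.
have [] := @xgetPex _ 0 [set y | skewherm y /\ opnorm y < pi /\ mxexp y = invmx u *m v].
  exists (sdec V (fun k => Complex 0 (th k))); split; first exact: sdec_imag_skewherm.
  split; last by rewrite mxexp_sdec // unitary_invmx.
  apply: le_lt_trans Bpi; apply: opnorm_sdec_le => // k; rewrite /nsq /= expr0n add0r.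
  by rewrite -real_normK ?num_real // lerXn2r ?nnegrE.
rewrite -/(mxlog _) => sy [oy ey]; have [W uW [et Ey]] := skewherm_sdec sy.
exists W, (fun k => (1 / 2) * et k); split => //.
- move=> i; have := opnorm_sdec_ge (fun k => Complex 0 (et k)) i uW; rewrite -Ey.
  rewrite /nsq /= expr0n add0r -(real_normK (num_real (et i))).
  rewrite ler_pXn2r ?nnegrE ?opnorm_ge0 // => H; rewrite normrM ger0_norm //.
  by have := le_lt_trans H oy; lra.
- by rewrite /geod Ey scale_sdec_imag mxexp_sdec.
rewrite sdecM // -unitary_invmx // -ey Ey mxexp_sdec //; apply: eq_sdec => k.
rewrite /comp -expiD; congr expi; lra.
Qed.

End ExpLog.

(** * Compactness, then existence and uniqueness of the circumcenter *)

Section Circumcenters.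
Context {R : realType}.
Local Notation C := R[i].
Local Notation cRe := (@complex.Re R).
Local Notation cIm := (@complex.Im R).

(** Bolzano-Weierstrass with a rate: a cluster point exists in a compact box, and [phi k] is chosen
    beyond [k] within [1 / (k + 1)] of it. *)
Lemma bounded_subseq (I : finType) (f : nat -> I -> R) (B : R) :
  (forall k i, `|f k i| <= B) -> exists (g : I -> R) (phi : nat -> nat),
  (forall k, (k <= phi k)%N) /\ forall i k, `|g i - f (phi k) i| < k.+1%:R^-1.
Proof.
move=> fB; pose N := #|I|.
pose u k : 'rV[R]_N := \row_j f k (enum_val j).
pose K : set 'rV[R]_N := [set v | forall i, [set` `[- B, B]%R] (v ord0 i)].
have cK : compact K.
  exact: (@rV_compact _ N (fun=> [set` `[- B, B]%R]) (fun=> @segment_compact R _ _)).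
have FK : (u @ \oo) K.
  by exists 0%N => // k _ i; rewrite /= in_itv /= mxE -ler_norml.
have [g [_ cg]] := cK (u @ \oo) _ FK.
have /choice[phi Hphi] : forall k, exists m : nat, (k <= m)%N /\
    forall j, `|g ord0 j - u m ord0 j| < k.+1%:R^-1.
  move=> k; have e0 : 0 < k.+1%:R^-1 :> R by rewrite invr_gt0.
  have Fk : (u @ \oo) [set u m | m in [set m | (k <= m)%N]].
    by exists k => // m km; exists m.
  have [_ [[m km <-] gm]] := cg _ _ Fk (nbhsx_ballx g _ e0).
  by exists m; split => // j; case: gm => _ /(_ ord0 j).
exists (fun i => g ord0 (enum_rank i)), phi; split => [k|i k]; first by case: (Hphi k).
by have [_ /(_ (enum_rank i))] := Hphi k; rewrite mxE enum_rankK.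
Qed.

Section Dimension.
Context {n : nat}.
Implicit Types (u v w c a m : 'M[C]_n) (M A : set 'M[C]_n) (p : nat).

Lemma unitary_nsq_le1 u i j : unitary R n u -> nsq (u i j) <= 1.
Proof.
move=> uu; have : \sum_k nsq (u i k) = 1.
  by rewrite sum_row_nsq unitary_mulmxV // mxE eqxx.
by rewrite (bigD1 j) //= => <-; rewrite lerDl sumr_ge0 // => k _; exact: nsq_ge0.
Qed.

Lemma sqr_le1_norm (r s : R) : r ^+ 2 + s ^+ 2 <= 1 -> `|r| <= 1.
Proof.
move=> H; have s0 := sqr_ge0 s; rewrite -(@ler_pXn2r _ 2) ?nnegrE //.
by rewrite real_normK ?num_real // expr1n; lra.
Qed.

Lemma unitary_subseq (c_ : nat -> 'M[C]_n) : (forall k, unitary R n (c_ k)) ->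
  exists w (phi : nat -> nat), [/\ unitary R n w, forall k, (k <= phi k)%N
    & cvg_mx \oo (c_ \o phi) w].
Proof.
move=> uc; pose f k (x : 'I_n * 'I_n * bool) :=
  if x.2 then cRe (c_ k x.1.1 x.1.2) else cIm (c_ k x.1.1 x.1.2).
have [|g [phi [kphi Hg]]] := @bounded_subseq _ f 1.
  move=> k [[i j] b]; have := unitary_nsq_le1 i j (uc k); rewrite /nsq /f /=.
  by case: b => /= H; [apply: sqr_le1_norm H|rewrite addrC in H; apply: sqr_le1_norm H].
pose w : 'M[C]_n := \matrix_(i, j) Complex (g (i, j, true)) (g (i, j, false)).
have cw : cvg_mx \oo (c_ \o phi) w.
  have cvgf (h : nat -> R) (l : R) : (forall k, `|l - h k| < k.+1%:R^-1) -> h @ \oo --> l.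
    move=> H; apply/cvgrPdist_lt => eps e0; near=> k.
    apply: lt_trans (H k) _; near: k; exact: near_infty_natSinv_lt (PosNum e0).
  move=> i j; rewrite mxE /=; split; apply: cvgf => k.
  - exact: (Hg (i, j, true) k).
  - exact: (Hg (i, j, false) k).
exists w, phi; split => //.
have cww : cvg_mx \oo (fun k => adjmx (c_ (phi k)) *m c_ (phi k)) (adjmx w *m w).
  exact: cvg_mxM (cvg_mx_adj cw) cw.
apply/matrixP => i j; have [cr ci] := cww i j.
have E k : adjmx (c_ (phi k)) *m c_ (phi k) = 1%:M by exact: (uc (phi k)).
apply: complex_eqP.
- have : (fun k => cRe ((adjmx (c_ (phi k)) *m c_ (phi k)) i j)) @ \oo --> cRe ((1%:M : 'M[C]_n) i j).
    rewrite (_ : (fun _ => _) = cst (cRe ((1%:M : 'M[C]_n) i j))); first exact: cvg_cst.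
    by apply/funext => k; rewrite E.
  by move/(cvg_unique _ cr); exact.
- have : (fun k => cIm ((adjmx (c_ (phi k)) *m c_ (phi k)) i j)) @ \oo --> cIm ((1%:M : 'M[C]_n) i j).
    rewrite (_ : (fun _ => _) = cst (cIm ((1%:M : 'M[C]_n) i j))); first exact: cvg_cst.
    by apply/funext => k; rewrite E.
  by move/(cvg_unique _ ci); exact.
Unshelve. all: by end_near. Qed.

Lemma cvg_frosq (c_ : nat -> 'M[C]_n) w : cvg_mx \oo c_ w ->
  frosq (c_ k - w) @[k --> \oo] --> (0 : R).
Proof.
move=> cw; rewrite -[X in _ --> X](_ : \sum_(i < n) \sum_(j < n) (0 : R) = 0); last first.
  by rewrite big1 // => i _; rewrite big1.
apply: cvg_bigsum => i; apply: cvg_bigsum => j; have [cr ci] := cw i j.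
rewrite (_ : (fun _ => _) = (fun k =>
   (cRe (c_ k i j) - cRe (w i j)) * (cRe (c_ k i j) - cRe (w i j)) +
   (cIm (c_ k i j) - cIm (w i j)) * (cIm (c_ k i j) - cIm (w i j)))); last first.
  by apply/funext => k; rewrite !mxE /nsq cReB cImB !expr2.
have sq (h : nat -> R) (l : R) : h @ \oo --> l -> (h k - l) * (h k - l) @[k --> \oo] --> (0 : R).
  move=> hl; have d0 : h k - l @[k --> \oo] --> (0 : R).
    by rewrite -(subrr l); apply: cvgB => //; exact: cvg_cst.
  by rewrite -[X in _ --> X](mulr0 0); exact: cvgM.
by rewrite -[X in _ --> X]addr0; apply: cvgD; exact: sq.
Qed.

Lemma frosq_adj_mull a u w : unitary R n a ->
  frosq (adjmx u *m a - adjmx w *m a) = frosq (u - w).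
Proof.
move=> ua; rewrite -mulmxBl frosqE adjmxM -mulmxA mxtrace_mulC.
rewrite -!mulmxA (unitary_mulmxV ua) mulmx1.
have -> : adjmx u - adjmx w = adjmx (u - w) by rewrite adjmxD adjmxN.
by rewrite adjmxK mxtrace_mulC -frosqE.
Qed.

(** Almost-centers for [r + 1 / (k + 1)] subconverge in the compact unitary group, and the limit
    lies in [M]. The bound passes to the limit for [p]-th powers, where [specpow_modulus]
    applies. *)
Lemma closed_ball_center p M A (r : R) : (2 <= p)%N -> ~~ odd p ->
  M `<=` unitary R n -> closed_in_unitary M -> A `<=` M -> 0 <= r ->
  (forall eps, 0 < eps -> exists2 c, M c & forall a, A a -> dp p c a <= r + eps) ->
  exists2 c, M c & forall a, A a -> dp p c a <= r.
Proof.
move=> p2 ep Mu Mcl AM r0 H; have p0 : (0 < p)%N by apply: leq_trans p2.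
have /choice[c_ Hc] : forall k : nat, exists c, M c /\
    forall a, A a -> dp p c a <= r + k.+1%:R^-1.
  by move=> k; have [|c Mc Hc] := H k.+1%:R^-1; [rewrite invr_gt0|exists c].
have [|w [phi [uw kphi cw]]] := @unitary_subseq c_.
  by move=> k; apply: Mu; case: (Hc k).
have Mw : M w by apply: (Mcl (c_ \o phi)) => // k; case: (Hc (phi k)).
exists w => // a Aa; have ua := Mu _ (AM _ Aa).
rewrite dpE // -(ler_pXn2r p0) ?nnegrE ?specdist_ge0 // specdistX //; last first.
  by apply: unitary_mul => //; exact: unitary_adj.
apply/ler_addgt0Pr => eps e0.
(* The thirds pay for the constant of the modulus, for [K * frosq], and for replacing [r] by
   [r + 1 / (k + 1)]. *)
have e3 : 0 < eps / 3 by rewrite divr_gt0.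
have [K K0 HK] := @specpow_modulus R n p (eps / 3) ep e3.
have c1 : K * frosq (c_ (phi k) - w) @[k --> \oo] --> (0 : R).
  by rewrite -[X in _ --> X](mulr0 K); apply: cvgMr; exact: cvg_frosq cw.
have c2 : (r + k.+1%:R^-1) ^+ p @[k --> \oo] --> r ^+ p.
  have : r + k.+1%:R^-1 @[k --> \oo] --> r.
    rewrite -[X in _ --> X]addr0; apply: cvgD; [exact: cvg_cst|exact: cvg_harmonic].
  by move=> cr; exact: (continuous_cvg _ (@exprn_continuous R p r) cr).
near \oo => k.
have k1 : K * frosq (c_ (phi k) - w) < eps / 3.
  have : `|0 - K * frosq (c_ (phi k) - w)| < eps / 3.
    by near: k; move/cvgrPdist_lt: c1; exact.
  by rewrite sub0r normrN; exact: le_lt_trans (ler_norm _).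
have k2 : (r + k.+1%:R^-1) ^+ p < r ^+ p + eps / 3.
  have : `|r ^+ p - (r + k.+1%:R^-1) ^+ p| < eps / 3.
    by near: k; move/cvgrPdist_lt: c2; exact.
  by rewrite distrC => /(le_lt_trans (ler_norm _)); rewrite ltrBlDl.
have [Mk Hk] := Hc (phi k); have uk := Mu _ Mk.
have k3 : specpow p (adjmx (c_ (phi k)) *m a) <= (r + k.+1%:R^-1) ^+ p.
  rewrite -specdistX //; last by apply: unitary_mul => //; exact: unitary_adj.
  rewrite -dpE // lerXn2r ?nnegrE ?addr_ge0 ?invr_ge0 //.
    by rewrite dpE // specdist_ge0.
  apply: le_trans (Hk a Aa) _.
  by rewrite lerD2l lef_pV2 ?posrE // ler_nat ltnS.
have := HK (adjmx (c_ (phi k)) *m a) (adjmx w *m a).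
move=> /(_ (unitary_mul (unitary_adj uk) ua) (unitary_mul (unitary_adj uw) ua)).
rewrite frosq_adj_mull // ler_norml => /andP[+ _]; lra.
Unshelve. all: by end_near. Qed.

Lemma midpoint_closer p M A (r : R) c1 c2 : (2 <= p)%N -> ~~ odd p ->
  geodesic_subset M -> A `<=` M -> A !=set0 -> r < pi / 2 -> M c1 -> M c2 -> c1 <> c2 ->
  (forall a, A a -> dp p c1 a <= r) -> (forall a, A a -> dp p c2 a <= r) ->
  exists2 m, M m & forall a, A a -> dp p m a < r.
Proof.
move=> p2 ep [Mu [_ Mgeo]] AM [a0 Aa0] rpi M1 M2 c12 H1 H2.
have p0 : (0 < p)%N by apply: leq_trans p2.
have u1 := Mu _ M1; have u2 := Mu _ M2; have ua a Aa := Mu _ (AM a Aa).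
(* The order is reversed to [adjmx a *m c] so that moving the center multiplies on the right, by [e]
   or its adjoint, as in [specpow_midpoint]. *)
have specE a c : A a -> unitary R n c -> dp p c a ^+ p = specpow p (adjmx a *m c).
  move=> Aa uc; have uca := unitary_mul (unitary_adj uc) (ua a Aa).
  rewrite dpE //; last exact: ua.
  rewrite specdistX // -specpow_adj // adjmxM adjmxK //.
have d0 a c : A a -> unitary R n c -> 0 <= dp p c a.
  by move=> Aa uc; rewrite dpE ?specdist_ge0 //; exact: ua.
have r0 : 0 <= r by apply: le_trans (H1 a0 Aa0); exact: d0.
have spec_le a c : A a -> unitary R n c -> dp p c a <= r -> specpow p (adjmx a *m c) <= r ^+ p.
  by move=> Aa uc dr; rewrite -specE // lerXn2r ?nnegrE ?d0.
have rp : r ^+ p < (pi / 2) ^+ p by rewrite ltrXn2r ?nnegrE ?divr_ge0 ?pi_ge0 // -lt0n.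
have [V uV [th hth E]] := unitary_sdec (unitary_mul (unitary_adj u1) u2).
have uaa := unitary_adj (ua a0 Aa0).
(* Both centers lie within [r < pi / 2] of the common point [a0], and translating them by [adjmx a0]
   leaves [adjmx c1 *m c2] unchanged. *)
have {}hth i : `|th i| < pi.
  apply: (@right_half_plane_angle _ _ p (adjmx a0 *m c1) (adjmx a0 *m c2) V th) => //.
  - exact: unitary_mul.
  - exact: unitary_mul.
  - by apply: le_lt_trans rp; apply: spec_le => //; exact: H1.
  - by apply: le_lt_trans rp; apply: spec_le => //; exact: H2.
  - rewrite -E adjmxM adjmxK -mulmxA (mulmxA a0).
    by rewrite (unitary_mulmxV (ua a0 Aa0)) mul1mx.
have dlt := dinf_lt_pi u1 u2 uV hth E.
have [W [et [uW het Eg Esq]]] := geod_half u1 u2 uV hth E.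
set e := sdec W (expi \o et) in Eg Esq.
have ue : unitary R n e by exact: sdec_expi_unitary.
pose m := c1 *m e; have um : unitary R n m by exact: unitary_mul.
have Mm : M m.
  rewrite /m -Eg; apply: Mgeo => //; apply/andP; split; lra.
have me2 : m *m e = c2.
  by rewrite /m -mulmxA Esq mulmxA (unitary_mulmxV u1) mul1mx.
have me1 : m *m adjmx e = c1.
  by rewrite /m -mulmxA (unitary_mulmxV ue) mulmx1.
have e1 : e <> 1%:M.
  by move=> e1; apply: c12; rewrite -me1 -me2 e1 adjmx1.
exists m => // a Aa; have uaa' := unitary_adj (ua a Aa).
have s1 := spec_le a c1 Aa u1 (H1 a Aa); have s2 := spec_le a c2 Aa u2 (H2 a Aa).
rewrite -(ltr_pXn2r p0) ?nnegrE ?d0 // specE //.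
have := @specpow_midpoint R n p (adjmx a *m m) e W et p2 ep (unitary_mul uaa' um) uW het erefl e1.
rewrite -(mulmxA _ m e) -(mulmxA _ m (adjmx e)) me1 me2.
move=> /(_ (le_lt_trans s2 rp) (le_lt_trans s1 rp)); lra.
Qed.

End Dimension.

(** Finiteness of [A] makes the improvement at the midpoint uniform, so that it contradicts the
    minimality of the radius. *)
Lemma finite_strict_bound (T : choiceType) (A : set T) (g : T -> R) (r : R) :
  finite_set A -> A !=set0 -> (forall a, A a -> g a < r) ->
  exists2 r', r' < r & forall a, A a -> g a <= r'.
Proof.
move=> /finite_seqP[s ->] [a0 a0s] H.
exists (\big[Num.max/g a0]_(a <- s) g a) => [|a as_].
  rewrite big_seq; apply: bigmax_lt => [|a]; [exact: H a0s|exact: H].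
exact: le_bigmax_seq.
Qed.

Lemma unique_circumcenter p n (M A : set 'M[C]_n) : (2 <= p)%N -> ~~ odd p ->
  geodesic_subset M -> closed_in_unitary M -> A `<=` M -> finite_set A -> A !=set0 ->
  set_radius M (@dp R p n) A < pi / 2 ->
  exists! c, circumcenter M (@dp R p n) A c.
Proof.
move=> p2 ep gM clM AM finA A0 rpi; have Mu : M `<=` unitary R n by case: gM.
set r := set_radius M (@dp R p n) A in rpi *.
pose S := [set r | exists2 c, M c & A `<=` cball M (@dp R p n) c r].
have bnd c : exists r', forall a, A a -> dp p c a <= r'.
  move: finA => /finite_seqP[s ->]; exists (\big[Num.max/0]_(a <- s) dp p c a) => a as_.
  exact: le_bigmax_seq.
have S_ge0 r' : S r' -> 0 <= r'.
  move=> [c Mc Hc]; have [a Aa] := A0; have [Ma da] := Hc a Aa.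
  by apply: le_trans da; rewrite dpE ?specdist_ge0 //; apply: Mu.
have infS : has_inf S.
  split; last by exists 0 => r' /S_ge0.
  have [a Aa] := A0; have [r' Hr'] := bnd a.
  by exists r'; exists a; [exact: AM|move=> x Ax; split; [exact: AM|exact: Hr']].
have r0 : 0 <= r by apply: lb_le_inf; [case: infS|move=> r' /S_ge0].
have r_le c r' : M c -> (forall a, A a -> dp p c a <= r') -> r <= r'.
  move=> Mc Hc; apply: ge_inf; first by case: infS.
  by exists c => // a Aa; split; [exact: AM|exact: Hc].
(* A center with all distances at most [r] has supremum exactly [r], since a smaller supremum would
   itself be an admissible radius. *)
have circP c : circumcenter M (@dp R p n) A c <-> M c /\ forall a, A a -> dp p c a <= r.
  have A1 : [set dp p c a | a in A] !=set0 by have [a Aa] := A0; exists (dp p c a), a.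
  split=> [[Mc Ec]|[Mc Hc]]; split => //.
    move=> a Aa; rewrite -/r in Ec; rewrite -Ec; apply: ub_le_sup; last by exists a.
    by have [r' Hr'] := bnd c; exists r' => _ [x Ax <-]; exact: Hr'.
  apply/eqP; rewrite eq_le -/r; apply/andP; split.
    by apply: ge_sup => // _ [x Ax <-]; exact: Hc.
  apply: (r_le c) => // a Aa; apply: ub_le_sup; last by exists a.
  by exists r => _ [x Ax <-]; exact: Hc.
have [c Mc Hc] : exists2 c, M c & forall a, A a -> dp p c a <= r.
  apply: closed_ball_center => // eps e0.
  have [r' [c Mc Hc] r'lt] := inf_adherent e0 infS.
  by exists c => // a Aa; have [_ /le_trans] := Hc a Aa; apply; exact: ltW.
exists c; split; first exact/circP.
move=> c' /circP[Mc' Hc']; apply: contrapT => cc'.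
have [m Mm Hm] := midpoint_closer p2 ep gM AM A0 rpi Mc Mc' cc' Hc Hc'.
have [r' r'lt Hr'] := finite_strict_bound finA A0 Hm.
by have := r_le m r' Mm Hr'; rewrite leNgt r'lt.
Qed.

(** * The whole unitary group as a geodesic subset, and the circle *)

Lemma unitary_geodesic_subset n : geodesic_subset (unitary R n).
Proof.
split; first by []; split=> [u v uu uv|u v uu uv _ t _]; last exact: unitary_geod.
have [V uV [th hth E]] := unitary_sdec (unitary_mul (unitary_adj uu) uv).
exists (spath u V th), [:: 0; 1], (fun=> spath u V th).
split; first exact: pw_path_spath.
by rewrite spath0 // spath1 -E mulmxA (unitary_mulmxV uu) mul1mx.
Qed.

Lemma scalar1_sdec (t : R) : (expi t)%:M = sdec 1%:M (expi \o (fun=> t)) :> 'M[C]_1.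
Proof.
rewrite /sdec adjmx1 mul1mx mulmx1; apply/matrixP => i j.
by rewrite !mxE !ord1.
Qed.

Lemma adjmx_expi_scalar (t : R) : adjmx ((expi t)%:M : 'M[C]_1) = (expi (- t))%:M.
Proof. by apply/matrixP => i j; rewrite adjmxE !mxE !ord1 /= -conjc_expi. Qed.

Lemma specdist_scalar p (t : R) : (2 <= p)%N -> ~~ odd p -> `|t| <= pi ->
  specdist p ((expi t)%:M : 'M[C]_1) = `|t|.
Proof.
move=> p2 ep tp; have p0 : (0 < p)%N by apply: leq_trans p2.
rewrite /specdist scalar1_sdec specpowE //; last exact: unitary1.
rewrite big_ord_recl big_ord0 addr0.
have -> : t ^+ p = `|t| ^+ p.
  rewrite -[p]odd_double_half (negbTE ep) add0n -mul2n !exprM.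
  by rewrite real_normK ?num_real.
by rewrite powR_rootX.
Qed.

Lemma unitary_scalar (t : R) : unitary R 1 (expi t)%:M.
Proof. by rewrite scalar1_sdec; apply: sdec_expi_unitary; exact: unitary1. Qed.

Lemma unitary1_expi (c : 'M[C]_1) : unitary R 1 c ->
  exists2 t : R, `|t| <= pi & c = (expi t)%:M.
Proof.
move=> uc; have c1 : nsq (c 0 0) = 1.
  have := unitary_mulmxV uc => /matrixP/(_ 0 0)/(congr1 cRe).
  by rewrite -sum_row_nsq big_ord_recl big_ord0 addr0 mxE.
have [t tp Et] := expi_argument c1; exists t => //.
by apply/matrixP => i j; rewrite !ord1 Et mxE.
Qed.

Lemma dp_circle_one p (t : R) : (2 <= p)%N -> ~~ odd p -> `|t| <= pi ->
  dp p ((expi t)%:M : 'M[C]_1) 1%:M = `|t|.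
Proof.
move=> p2 ep tp; rewrite dpE //; [|exact: unitary_scalar|exact: unitary1].
by rewrite mulmx1 adjmx_expi_scalar specdist_scalar ?normrN.
Qed.

Lemma dp_circle_minus_one p (t : R) : (2 <= p)%N -> ~~ odd p -> `|t| <= pi ->
  dp p ((expi t)%:M : 'M[C]_1) (- 1%:M) = pi - `|t|.
Proof.
move=> p2 ep tp; have pi0 := @pi_ge0 R.
have E : - 1%:M = (expi pi)%:M :> 'M[C]_1.
  apply/matrixP => i j; rewrite !mxE !ord1 /= !mulr1n.
  by apply: complex_eqP; rewrite ?cReN ?cImN /= ?cospi ?sinpi ?oppr0.
rewrite E dpE //; [|exact: unitary_scalar|exact: unitary_scalar].
rewrite adjmx_expi_scalar -scalar_mxM -expiD.
have [t0|t0] := leP 0 t.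
  rewrite ger0_norm // in tp *; rewrite specdist_scalar //; last first.
    by rewrite ler_norml; apply/andP; split; lra.
  by rewrite ger0_norm; lra.
rewrite ltr0_norm // in tp *.
(* For negative [t] the angle [- t + pi] exceeds [pi]; a full turn brings it back. *)
have -> : expi (- t + pi) = expi (- t - pi) :> C.
  have -> : - t + pi = (- t - pi) + pi *+ 2 by rewrite -mulr_natr; ring.
  by rewrite /expi cosD2pi sinD2pi.
rewrite specdist_scalar //; last by rewrite ler_norml; apply/andP; split; lra.
by rewrite ler0_norm; lra.
Qed.

(** The distances from [expi t] to [1] and [-1] add up to [pi], so the larger is at least [pi / 2],
    with equality exactly when [|t| = pi / 2]. *)
Lemma circle_circumcenters p : (2 <= p)%N -> ~~ odd p ->
  set_radius (unitary R 1) (@dp R p 1) [set 1%:M; - 1%:M] = pi / 2 /\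
  [set c | circumcenter (unitary R 1) (@dp R p 1) [set 1%:M; - 1%:M] c]
    = [set (Complex 0 1)%:M; - (Complex 0 1)%:M].
Proof.
move=> p2 ep; have pi0 := @pi_gt0 R.
have p22 : `|pi / 2 : R| <= pi by rewrite ger0_norm; lra.
have m22 : `|- (pi / 2) : R| <= pi by rewrite normrN.
have uN1 : unitary R 1 (- 1%:M) by rewrite /unitary /= adjmxN adjmx1 mulmxN mulNmx mulmx1 opprK.
have iE : (Complex 0 1 : C) = expi (pi / 2) by rewrite /expi cos_pihalf sin_pihalf.
have jE : - (Complex 0 1)%:M = (expi (- (pi / 2)))%:M :> 'M[C]_1.
  apply/matrixP => i j; rewrite !mxE !ord1 /= !mulr1n.
  by apply: complex_eqP; rewrite ?cReN ?cImN /= ?cosN ?sinN ?cos_pihalf ?sin_pihalf ?oppr0.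
have rE : set_radius (unitary R 1) (@dp R p 1) [set 1%:M; - 1%:M] = pi / 2.
  set S := [set r | exists2 c, unitary R 1 c &
    [set 1%:M; - 1%:M] `<=` cball (unitary R 1) (@dp R p 1) c r].
  have lbS : lbound S (pi / 2).
    move=> r [c uc Hc]; have [t tp Ec] := unitary1_expi uc.
    have [_] : cball (unitary R 1) (@dp R p 1) c r 1%:M by apply: Hc; left.
    have [_] : cball (unitary R 1) (@dp R p 1) c r (- 1%:M) by apply: Hc; right.
    by rewrite Ec dp_circle_one // dp_circle_minus_one //; lra.
  have Spi : S (pi / 2).
    exists (expi (pi / 2))%:M; first exact: unitary_scalar.
    move=> a [|] ->; split; rewrite ?dp_circle_one ?dp_circle_minus_one //;
      rewrite ?ger0_norm //; try lra; exact: unitary1.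
  apply/eqP; rewrite eq_le; apply/andP; split.
    by apply: ge_inf Spi; exists (pi / 2).
  by apply: lb_le_inf => //; exists (pi / 2).
split => //; apply/seteqP; split => c; rewrite /circumcenter /= rE.
  move=> [uc sc]; have [t tp Ec] := unitary1_expi uc.
  have ub : has_ubound [set dp p c a | a in [set 1%:M; - 1%:M]].
    by have t0 := normr_ge0 t; exists pi => _ [a [|] -> <-]; rewrite Ec ?dp_circle_one ?dp_circle_minus_one //; lra.
  have h1 : dp p c 1%:M <= pi / 2 by rewrite -sc; apply: ub_le_sup => //; exists 1%:M => //; left.
  have h2 : dp p c (- 1%:M) <= pi / 2 by rewrite -sc; apply: ub_le_sup => //; exists (- 1%:M) => //; right.
  move: h1 h2; rewrite Ec dp_circle_one // dp_circle_minus_one // => h1 h2.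
  have {h1 h2}tE : `|t| = pi / 2 by lra.
  rewrite jE iE; have [t0|t0] := leP 0 t.
    by left; move: tE; rewrite ger0_norm // => ->.
  by right; move: tE; rewrite ltr0_norm // => <-; rewrite opprK.
move=> Hc; have [t [tp tE Ec]] : exists t : R, [/\ `|t| <= pi, `|t| = pi / 2 & c = (expi t)%:M].
  case: Hc => ->; [exists (pi / 2); rewrite iE|exists (- (pi / 2)); rewrite jE];
    by split => //; rewrite ?normrN ger0_norm; lra.
rewrite Ec; split; first exact: unitary_scalar.
have d1 : dp p ((expi t)%:M : 'M[C]_1) 1%:M = pi / 2 by rewrite dp_circle_one.
have d2 : dp p ((expi t)%:M : 'M[C]_1) (- 1%:M) = pi / 2.
  by rewrite dp_circle_minus_one // tE; lra.
rewrite (_ : [set _ | _ in _] = [set pi / 2]) ?sup1 //.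
apply/seteqP; split=> x /=; first by move=> [a [|] -> <-].
by move=> ->; exists 1%:M => //; left.
Qed.

End Circumcenters.

Theorem theorem4p7 (R : realType) :
  (forall (p n : nat) (M A : set 'M[R[i]]_n),
      (2 <= p)%N -> ~~ odd p ->
      geodesic_subset M -> closed_in_unitary M ->
      A `<=` M -> finite_set A -> A !=set0 ->
      set_radius M (@dp R p n) A < pi / 2 ->
      exists! c : 'M[R[i]]_n, circumcenter M (@dp R p n) A c)
  /\
  (forall p : nat, (2 <= p)%N -> ~~ odd p ->
      geodesic_subset (unitary R 1) /\ closed_in_unitary (unitary R 1) /\
      set_radius (unitary R 1) (@dp R p 1) [set 1%:M; - 1%:M] = pi / 2 /\
      [set c | circumcenter (unitary R 1) (@dp R p 1) [set 1%:M; - 1%:M] c]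
        = [set (Complex 0 1)%:M; - (Complex 0 1)%:M]).
Proof.
split=> [p n M A|p p2 ep]; first exact: unique_circumcenter.
have [rE cE] := @circle_circumcenters R p p2 ep.
split; first exact: unitary_geodesic_subset.
by split=> [u w _ uw _|].
Qed.
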